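(* Let $X,Y,Z,W$ be locally convex Hausdorff topological vector spaces, $K\subset Y$ a proper closed convex cone with $\operatorname{int}K\ne\emptyset$, $P\subset W$ and $S\subset Z$ nonempty convex cones, $F\colon X\to Y^\infty$, $\kappa\colon W\to Y^\infty$, $H\colon X\to W^\infty$, $G\colon X\to Z^\infty$ proper mappings, $C\subset X$ nonempty, $A=C\cap G^{-1}(-S)$, and assume $A\cap\operatorname{dom}F\cap H^{-1}(\operatorname{dom}\kappa)\neq\emptyset$. Assume that $F$ is $K$-convex, $H$ is $P$-convex, $G$ is $S$-convex, $\kappa$ is $K$-convex and $(P,K)$-nondecreasing, and $C$ is convex. Let $$Z_0^2=\operatorname{lin}\big[\{(x,H(x),G(x)):x\in C\cap\operatorname{dom}H\cap\operatorname{dom}G\}-\operatorname{dom}F\times\operatorname{dom}\kappa\times(-S)\big]\subset X\times W\times Z,$$ and assume that for every $L\in\mathcal L(X,Y)$ there exist $y_L\in Y$ and a neighborhood $W_L$ of $(0_X,0_W,0_Z)$ such that for every $(x',w,z)\in W_L\cap Z_0^2$ there is $x\in C$ with $G(x)+z\in-S$ and $F(x+x')+\kappa(H(x)+w)-L(x)\leqq_Ky_L$. Then stable strong duality holds for the pairs $(\mathrm{CCVP})-(\mathrm{CCVD}^2)$ and $(\mathrm{CCVP})-(\mathrm{CCVD}^2_\ell)$; that is, for every $L\in\mathcal L(X,Y)$, $$\operatorname{WInf}\{F(x)+(\kappa\circ H)(x)-L(x):x\in A\}=\operatorname{WMax}D_L=\operatorname{WMax}D_L^+,$$ where $D_L$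 is the union over $L'\in\mathcal L(X,Y)$, $T_1\in\operatorname{dom}\kappa^*$, $T_2\in\mathcal L_+^w(S,K)$ of the sets $$-\big[F^*(L')\uplus(T_1\circ H+T_2\circ G+I_C)^*(L-L')\uplus\kappa^*(T_1)\uplus I_{-S}^*(T_2)\big],$$ and $D_L^+$ is the union over $L'\in\mathcal L(X,Y)$, $T_1\in\operatorname{dom}\kappa^*\cap\mathcal L_+(P,K)$, $T_2\in\mathcal L_+(S,K)$ of the sets $$-\big[F^*(L')\uplus(T_1\circ H+T_2\circ G+I_C)^*(L-L')\uplus\kappa^*(T_1)\big].$$
   Context: Ordering: $K$ proper means $K\neq Y$. $y_1\leqq_Ky_2$ iff $y_1-y_2\in-K$; $y_1<_K y_2$ iff $y_1-y_2\in-\operatorname{int}K$. $Y^\infty=Y\cup\{+\infty_Y\}$, $Y^\bullet=Y\cup\{\pm\infty_Y\}$, with $-\infty_Y<_Ky<_K+\infty_Y$ for $y\in Y$, $-\infty_Y<_K+\infty_Y$, $-(\pm\infty_Y)=\mp\infty_Y$, $y+(+\infty_Y)=+\infty_Y$ for $y\in Y^\infty$, $M+\{+\infty_Y\}=\{+\infty_Y\}$ for $M\subset Y$; $y\leqq_K+\infty_Y$ for all $y\in Y^\infty$ and $+\infty_Y\not\leqq_Ky$ for $y\in Y$. Similarly $W^\infty=W\cup\{+\infty_W\}$, $Z^\infty=Z\cup\{+\infty_Z\}$. For $M\subset Y^\bullet$: $\operatorname{WSup}M$ is the set of $\bar v\in Y^\bullet$ such that $\bar v\not<_Kv$ for all $v\in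 M$ and for every $\tilde v\in Y^\bullet$ with $\tilde v<_K\bar v$ there is $v\in M$ with $\tilde v<_Kv$; $\operatorname{WInf}M=-\operatorname{WSup}(-M)$; $\operatorname{WMax}M=M\cap\operatorname{WSup}M$. $\operatorname{dom}$ is the set of points where a mapping is not $+\infty$; a mapping into $Y^\infty$, $W^\infty$, $Z^\infty$ is proper if its domain is nonempty. A mapping $E$ is $Q$-convex ($Q$ a convex cone in the target space) if $\{(x,y):x\in\operatorname{dom}E,\ y\in E(x)+Q\}$ is convex. $\kappa$ is $(P,K)$-nondecreasing if $w_1-w_2\in-P$ implies $\kappa(w_1)\leqq_K\kappa(w_2)$. $\kappa(+\infty_W)=+\infty_Y$. $\mathcal L(\cdot,\cdot)$ denotes continuous linear maps. For $T\in\mathcal L(Z,Y)$, $(T\circ G)(x)=T(G(x))$ if $G(x)\in Z$ and $+\infty_Y$ otherwise; likewise $T\circ H$. $I_D(x)=0_Y$ if $x\in D$, $+\infty_Y$ otherwise. For $E\colon X\to Y^\infty$, $E^*(L)=\operatorname{WSup}\{L(x)-E(x):x\in X\}$ and $\operatorname{dom}E^*=\{L:E^*(L)\neq\{+\infty_Y\}\}$; likewise for mappings on $W$, $Z$ ($\kappa^*$, $I_{-S}^*$). $\mathcal L_+(S,K)=\{T\in\mathcal L(Z,Y):T(S)\subset K\}$, $\mathcal L_+^w(S,K)=\{T\in\mathcal L(Z,Y):T(S)\cap(-\operatorname{int}K)=\emptyset\}$, $\mathcal L_+(P,K)$ analogously. $\operatorname{lin}$ is the linear hull. $\mathcal P_p(Y)$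 is the collection of $U\subset Y$ such that $Y$ is the disjoint union of $U-\operatorname{int}K$, $U$, $U+\operatorname{int}K$; for $U,V\in\mathcal P_p(Y)\cup\{\{+\infty_Y\}\}$, $U\uplus V=\operatorname{WSup}(U+V)$ (a commutative, associative operation; the conjugate values above belong to this collection). $(\mathrm{CCVP})$ is the problem $\operatorname{WInf}\{F(x)+(\kappa\circ H)(x):x\in C,\ G(x)\in-S\}$; $(\mathrm{CCVD}^2)$ and $(\mathrm{CCVD}^2_\ell)$ are its Fenchel-Lagrange duals, obtained from $D_L$ and $D_L^+$ with $L=0$.
   Formalization: The formal theorem additionally assumes that dom κ* is nonempty; without it the claim fails (e.g. κ a discontinuous linear functional, F=0, G=0, H=id, P=S={0}, Y=ℝ), since D_L is then empty while WInf is {−∞}. *)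

(* Defs.v *)
From HB Require Import structures.
From mathcomp Require Import all_boot all_order all_algebra.
From mathcomp Require Import all_classical all_reals all_analysis.

Set Implicit Arguments.
Unset Strict Implicit.
Unset Printing Implicit Defensive.

Import Order.TTheory GRing.Theory Num.Theory.
Import numFieldNormedType.Exports.

Local Open Scope classical_set_scope.
Local Open Scope ring_scope.

(* Conventions.
   - A locally convex Hausdorff space is a [V : tvsType R] with
     [hausdorff_space V], over [R : realType].
   - V^infty = V \cup {+oo} is [option V], with [None] as +oo.
   - Y^bullet = Y \cup {-oo, +oo} is the library's [\bar Y], with its [+] and
     [-]; the sum (+oo) + (-oo), which the library sets to -oo, never arises in
     the sets built from mappings into Y^infty below.
   - Continuous linear maps are the [T : {linear V -> U}] with [continuous T]. *)

Definition bar {V : Type} (v : option V) : \bar V :=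
  if v is Some a then a%:E else +oo%E.

Definition opp_set (V : zmodType) (A : set V) : set V := [set - x | x in A].

Definition domain (V U : Type) (E : V -> option U) : set V :=
  [set x | E x <> None].

Definition proper_map (V U : Type) (E : V -> option U) : Prop :=
  domain E !=set0.

Definition comp_ext (V U T : Type) (f : U -> option T) (g : V -> option U) :
  V -> option T := fun x => obind f (g x).

Section Cones.
Context {R : realType}.
Implicit Types V U : lmodType R.

(* The origin need not belong to a cone. *)
Definition convex_cone V (A : set V) : Prop :=
  @convex_set R V A /\ forall (t : R) x, 0 < t -> A x -> A (t *: x).

Definition cone_convex V U (Q : set U) (E : V -> option U) : Prop :=
  @convex_set R (V * U)%type
    [set p | exists2 e, E p.1 = Some e & exists2 q, Q q & p.2 = e + q].

Definition lin V (A : set V) : set V :=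
  smallest (fun U : set V => submod_closed (mem U)) A.

End Cones.

Section Order.
Context {R : realType} {Y : tvsType R}.
Variable K : set Y.

Definition leK (u v : \bar Y) : Prop :=
  match u, v with
  | y1%:E, y2%:E => opp_set K (y1 - y2)%R
  | -oo, _ | _, +oo => True
  | _, _ => False
  end%E.

Definition ltK (u v : \bar Y) : Prop :=
  match u, v with
  | y1%:E, y2%:E => opp_set K^° (y1 - y2)%R
  | -oo, _%:E | -oo, +oo | _%:E, +oo => True
  | _, _ => False
  end%E.

Definition WSup (M : set (\bar Y)) : set (\bar Y) :=
  [set v | (forall u, M u -> ~ ltK v u) /\
           forall w, ltK w v -> exists2 u, M u & ltK w u].

Definition WInf (M : set (\bar Y)) : set (\bar Y) :=
  -%E @` WSup (-%E @` M).

Definition WMax (M : set (\bar Y)) : set (\bar Y) := M `&` WSup M.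

Definition uplus (U V : set (\bar Y)) : set (\bar Y) :=
  WSup [set (u + v)%E | u in U & v in V].

Definition indicator (V : Type) (D : set V) (x : V) : \bar Y :=
  if x \in D then 0%E else +oo%E.

Definition conjugate (V : tvsType R) (E : V -> \bar Y) (L : V -> Y) :
    set (\bar Y) :=
  WSup [set ((L x)%:E - E x)%E | x in setT].

Definition contlin {V : tvsType R} : set {linear V -> Y} :=
  [set T | continuous T].

Definition dom_conj (V : tvsType R) (E : V -> \bar Y) : set {linear V -> Y} :=
  [set T | contlin T /\ conjugate E T <> [set +oo%E]].

Definition Lplus (V : tvsType R) (S : set V) : set {linear V -> Y} :=
  [set T | contlin T /\ T @` S `<=` K].

Definition Lplusw (V : tvsType R) (S : set V) : set {linear V -> Y} :=
  [set T | contlin T /\ T @` S `&` opp_set K^° = set0].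

Definition nondecreasing_cone (W : tvsType R) (P : set W)
    (kappa : W -> option Y) : Prop :=
  forall w1 w2, opp_set P (w1 - w2) ->
    leK (bar (kappa w1)) (bar (kappa w2)).

End Order.

Section Problem.
Context {R : realType} {X Y Z W : tvsType R}.
Variables (K : set Y) (P : set W) (S : set Z).
Variables (F : X -> option Y) (kappa : W -> option Y).
Variables (H : X -> option W) (G : X -> option Z) (C : set X).

Definition feasible : set X :=
  C `&` [set x | exists2 s, S s & G x = Some (- s)].

Definition primal_values (L : X -> Y) : set (\bar Y) :=
  [set (bar (F x) + bar (comp_ext kappa H x) - (L x)%:E)%E | x in feasible].

Definition lagrange (T1 : W -> Y) (T2 : Z -> Y) (x : X) : \bar Y :=
  (bar (omap T1 (H x)) + bar (omap T2 (G x)) + indicator C x)%E.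

Definition dual_values (L : {linear X -> Y}) : set (\bar Y) :=
  \bigcup_(L' in contlin) \bigcup_(T1 in dom_conj K (bar \o kappa))
  \bigcup_(T2 in Lplusw K S)
    (-%E @` uplus K (uplus K (uplus K
       (conjugate K (bar \o F) L')
       (conjugate K (lagrange T1 T2) (L \- L')))
       (conjugate K (bar \o kappa) T1))
       (conjugate K (indicator (opp_set S)) T2)).

Definition dual_values_plus (L : {linear X -> Y}) : set (\bar Y) :=
  \bigcup_(L' in contlin)
  \bigcup_(T1 in dom_conj K (bar \o kappa) `&` Lplus K P)
  \bigcup_(T2 in Lplus K S)
    (-%E @` uplus K (uplus K
       (conjugate K (bar \o F) L')
       (conjugate K (lagrange T1 T2) (L \- L')))
       (conjugate K (bar \o kappa) T1)).

Definition Z0 : set (X * W * Z) :=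
  lin [set a - b | a in [set p | [/\ C p.1.1, H p.1.1 = Some p.1.2
                                    & G p.1.1 = Some p.2]]
                 & b in domain F `*` domain kappa `*` opp_set S].

End Problem.

(* Main.v *)
Require Import Defs.
From HB Require Import structures.
From mathcomp Require Import all_boot all_order all_algebra.
From mathcomp Require Import all_classical all_reals all_analysis.
From mathcomp Require Import ring lra.

Set Implicit Arguments.
Unset Strict Implicit.
Unset Printing Implicit Defensive.

Import Order.TTheory GRing.Theory Num.Theory.
Import numFieldNormedType.Exports.

Local Open Scope classical_set_scope.
Local Open Scope ring_scope.

(* Scalarization. If [y0] is a point of the weak infimum of the perturbed primal
   values, the convex set of all (perturbation, value - y0 + interior point of K)
   misses the origin, and the qualification condition makes it absorbing inside
   the span [Z0]. It can therefore be separated from the origin by a functional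
   (a, b, d, l) that is bounded on a neighbourhood of the origin, nonnegative on
   K in its last component, and normalized by l(k) = 1 at an interior point k of
   K. The rank-one operators a k, b k, d k are then optimal dual variables, so
   vector duality needs only scalar multipliers. Finally a weak supremum depends
   only on the set of points strictly below its argument, hence iterated [uplus]
   collapses to the weak supremum of a Minkowski sum. *)

(** The qualification condition only controls perturbations inside [Z0], whereas the dual operators
    must be continuous on all of [X], [W] and [Z]. Instead of extending a functional from the span,
    the set to be separated is enlarged by a cone over a full convex neighbourhood; the resulting
    bound on that neighbourhood yields continuity. A second obstacle is that [P] and [S] may lack
    the origin: slacks are kept as genuine elements of the cones and removed by letting a scalar [t]
    tend to 0. Separation also needs a finite point; when the weak infimum is -oo there is none, and
    a multiplier has to be built from an element of the domain of the conjugate of [kappa]. Both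
    equalities come from one sandwich: optimal variables are found in the smaller
    [dual_values_plus], and weak duality is proved for the larger [dual_values]. *)

Section LinearCombinations.
Context {R : realType} {V : lmodType R}.

Inductive lterm :=
  | LVar of nat | LZero | LAdd of lterm & lterm | LOpp of lterm
  | LScale of R & lterm.

Fixpoint leval (env : seq V) t : V :=
  match t with
  | LVar n => nth 0 env n
  | LZero => 0
  | LAdd a b => leval env a + leval env b
  | LOpp a => - leval env a
  | LScale r a => r *: leval env a
  end.

Fixpoint lcoef t (i : nat) : R :=
  match t with
  | LVar n => if Nat.eqb n i then 1 else 0
  | LZero => 0
  | LAdd a b => lcoef a i + lcoef b i
  | LOpp a => - lcoef a i
  | LScale r a => r * lcoef a i
  end.

Lemma levalE env t : leval env t = \sum_(i < size env) lcoef t i *: env`_i.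
Proof.
elim: t => [n||a IHa b IHb|a IHa|r a IHa] /=.
- have eqbE m i : Nat.eqb m i = (m == i) by elim: m i => [|m IHm] [|i] //=.
  have [n_env|env_n] := ltnP n (size env).
    rewrite (bigD1 (Ordinal n_env))//= eqbE eqxx scale1r big1 ?addr0// => i ni.
    by rewrite eqbE eq_sym -[n]/(val (Ordinal n_env)) val_eqE (negPf ni) scale0r.
  rewrite nth_default// big1// => i _.
  by rewrite eqbE gtn_eqF ?scale0r// (leq_trans _ env_n).
- by rewrite big1// => i _; rewrite scale0r.
- by rewrite IHa IHb -big_split; apply: eq_bigr => i _; rewrite scalerDl.
- by rewrite IHa -sumrN; apply: eq_bigr => i _; rewrite scaleNr.
- by rewrite IHa scaler_sumr; apply: eq_bigr => i _; rewrite scalerA.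
Qed.

(** A conjunction computed by recursion, so that [cbn] turns it into finitely many scalar goals for
    [split]; [lcoef] uses [Nat.eqb] for the same reason. *)
Fixpoint lcoef_eq t u (n : nat) : Prop :=
  if n is m.+1 then lcoef t m = lcoef u m /\ lcoef_eq t u m else True.

Lemma leval_eq env t u : lcoef_eq t u (size env) -> leval env t = leval env u.
Proof.
move=> tu; rewrite !levalE; apply: eq_bigr => -[i i_env] _ /=; congr (_ *: _).
elim: (size env) tu i_env => //= n IHn [tun /IHn{}IHn].
by rewrite ltnS leq_eqVlt => /predU1P[->|/IHn].
Qed.

End LinearCombinations.

Ltac lindex v env :=
  match env with
  | v :: _ => constr:(0%N)
  | _ :: ?env' => let n := lindex v env' in constr:(n.+1)
  end.

Ltac lenv e env :=
  match e with
  | GRing.add ?a ?b => let env' := lenv a env in lenv b env'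
  | GRing.opp ?a => lenv a env
  | GRing.scale ?r ?a => lenv a env
  | GRing.zero => env
  | _ => match env with
         (* [lindex] fails on a new atom, and the match then falls through to the branch that
            records it. *)
         | _ => let _ := lindex e env in env
         | _ => constr:(e :: env)
         end
  end.

Ltac lquote R e env :=
  match e with
  | GRing.add ?a ?b =>
      let a' := lquote R a env in let b' := lquote R b env in
      constr:(@LAdd R a' b')
  | GRing.opp ?a => let a' := lquote R a env in constr:(@LOpp R a')
  | GRing.scale ?r ?a => let a' := lquote R a env in constr:(@LScale R r a')
  | GRing.zero => constr:(@LZero R)
  | _ => let n := lindex e env in constr:(@LVar R n)
  end.

(* Reduces an identity between linear combinations in a module over [R] to the
   identities between the coefficients of each vector, left to [field]. *)
Ltac lmod R :=
  match goal with
  | |- ?e1 = ?e2 :> ?V =>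
      let env := lenv e1 (@nil V) in
      let env := lenv e2 env in
      let t1 := lquote R e1 env in
      let t2 := lquote R e2 env in
      apply: (@leval_eq R _ env t1 t2); cbn [lcoef_eq lcoef size Nat.eqb];
      repeat split; try by field
  end.

(** * Separation of convex sets *)

Section ConvexSets.
Context {R : realType} {V : lmodType R}.
Implicit Types (A N : set V) (s t : R).

Lemma convex_combination A t x y :
  convex_set A -> 0 <= t <= 1 -> A x -> A y -> A (t *: x + (1 - t) *: y).
Proof.
move=> cA t01 Ax Ay; have t01' : Itv.spec (@Itv.num_sem R) (Itv.Real `[0%Z, 1%Z]) t.
  by rewrite /= /Itv.num_sem in_itv/= t01 andbT ger0_real; case/andP: t01.
by have := cA x y (Itv.mk t01') (mem_set Ax) (mem_set Ay) => /set_mem.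
Qed.

Lemma convex_setI_strict A :
  (forall t x y, 0 < t < 1 -> A x -> A y -> A (t *: x + (1 - t) *: y)) ->
  convex_set A.
Proof.
move=> cA; apply/convex_setW => x y xA yA k k0 k1.
apply/mem_set/cA; [|exact: set_mem..].
by rewrite k0.
Qed.

Lemma convex_coneD A x y : convex_cone A -> A x -> A y -> A (x + y).
Proof.
move=> [cA coneA] Ax Ay.
have -> : x + y = 2%:R *: (2%:R^-1 *: x + (1 - 2%:R^-1) *: y) by lmod R.
by apply: coneA; [lra|apply: convex_combination => //; lra].
Qed.

Section Separation.
Variables (N : set V) (k : V).
Hypotheses (convN : convex_set N) (N0 : ~ N 0).
Hypothesis upN : forall x t, 0 <= t -> N x -> N (x + t *: k).
Hypothesis absN : forall v, exists t, N (v + t *: k).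

Let wedge A := [/\ forall x y, A x -> A y -> A (x + y),
  forall t x, 0 < t -> A x -> A (t *: x), A 0, ~ A (- k) & N `<=` A].

Let hull : set V := [set x | exists2 t, 0 <= t & exists2 n, N n & x = t *: n].

Let k_neq0 : k <> 0.
Proof. by move=> k0; have [t] := absN 0; rewrite k0 scaler0 addr0. Qed.

Let wedge_hull : wedge hull.
Proof.
split.
- move=> _ _ [s s0 [m Nm ->]] [t t0 [n Nn ->]].
  have [st0|st_neq0] := eqVneq (s + t) 0.
    have [-> ->] : s = 0 /\ t = 0 by lra.
    by exists 0 => //; exists m => //; rewrite !scale0r addr0.
  have st_gt0 : 0 < s + t by rewrite lt_def st_neq0 addr_ge0.
  exists (s + t); first lra.
  exists ((s / (s + t)) *: m + (1 - s / (s + t)) *: n); last by lmod R.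
  apply: convex_combination => //.
  by rewrite divr_ge0 ?ler_pdivrMr ?mul1r ?lerDl ?addr_ge0.
- move=> t _ t0 [s s0 [n Nn ->]]; exists (t * s); first by rewrite mulr_ge0// ltW.
  by exists n; rewrite ?scalerA.
- have [t Nt] := absN 0; exists 0 => //.
  by exists (0 + t *: k) => //; rewrite scale0r.
- move=> [t t0 [n Nn kE]]; have [t00|t_neq0] := eqVneq t 0.
    by move: kE; rewrite t00 scale0r => /eqP; rewrite oppr_eq0 => /eqP /k_neq0.
  (* From [- k = t *: n] with [t > 0], moving [n] by [t^-1 *: k] reaches the origin, so [upN] would
     put 0 in [N]. *)
  have := upN _ Nn; move=> /(_ t^-1); rewrite invr_ge0 => /(_ t0).
  suff -> : n + t^-1 *: k = 0 by [].
  by rewrite -[k]opprK kE; lmod R.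
- by move=> n Nn; exists 1 => //; exists n => //; rewrite scale1r.
Qed.

Let maximal_wedge : exists2 A, wedge A & forall B, A `<=` B -> wedge B -> B `<=` A.
Proof.
have [F FP Ftot|A [PA Amax]] := @Zorn_bigcup V [set A | A = set0 \/ wedge A].
  have [[M FM wM]|noF] := pselect (exists2 M, F M & wedge M); last first.
    left; rewrite -subset0 => x [X FX Xx].
    by have [X0|wX] := FP _ FX; [rewrite X0 in Xx|apply: noF; exists X].
  have wF X x : F X -> X x -> wedge X.
    by move=> FX Xx; case: (FP _ FX) => // X0; rewrite X0 in Xx.
  right; split.
  - move=> x y [X FX Xx] [Y FY Yy]; have [XY|YX] := Ftot _ _ FX FY.
      by exists Y => //; have [+ _ _ _ _] := wF _ _ FY Yy; apply => //; exact: XY.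
    by exists X => //; have [+ _ _ _ _] := wF _ _ FX Xx; apply => //; exact: YX.
  - move=> t x t0 [X FX Xx]; exists X => //.
    by have [_ + _ _ _] := wF _ _ FX Xx; apply.
  - by exists M => //; case: wM.
  - by move=> [X FX Xx]; have [_ _ _ + _] := wF _ _ FX Xx; apply.
  - by move=> x Nx; exists M => //; case: wM => _ _ _ _; apply.
exists A.
  case: PA => // A0; exfalso; apply: (Amax hull); last by right.
  split; first by rewrite A0.
  by rewrite A0 => hull0; case: wedge_hull => _ _ /hull0.
move=> B AB wB; apply: contrapT => nBA.
by apply: (Amax B); [split|right].
Qed.

(* A maximal convex cone [A] containing [N] but not [- k] satisfies
   [A \/ - A = V]; it is the nonnegative half-space of the functional sought. *)
Lemma separation : exists l : V -> R,
  [/\ scalar l, l k = 1 & forall x, N x -> 0 <= l x].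
Proof.
have [A [AD AZ A0 Ank NA] Amax] := maximal_wedge.
have Ak_ge0 t : A (t *: k) -> 0 <= t.
  move=> Atk; rewrite leNgt; apply/negP => t0; apply: Ank.
  have ? := lt_eqF t0.
  have -> : - k = (- t^-1) *: (t *: k) by lmod R; field; lra.
  by apply: AZ => //; rewrite oppr_gt0 invr_lt0.
have Ak : A k.
  have [t Nt] := absN 0; have [t0|t_neq0] := eqVneq t 0.
    by move: Nt; rewrite t0 scale0r addr0.
  move: Nt; rewrite add0r => /NA Atk; have t_ge0 := Ak_ge0 _ Atk.
  have -> : k = t^-1 *: (t *: k) by lmod R.
  by apply: AZ => //; rewrite invr_gt0 lt_def t_neq0.
have Ak_up t x : 0 <= t -> A x -> A (x + t *: k).
  rewrite le_eqVlt => /predU1P[<-|t0] Ax; first by rewrite scale0r addr0.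
  by apply: AD => //; exact: AZ.
have total v : A v \/ A (- v).
  apply: contrapT => /not_orP[nAv nANv].
  (* The cone generated by [A] and [v]. It could only fail to be a wedge by containing [- k], which
     would put [- v] in [A]; so maximality forces [v] into [A]. *)
  pose B : set V := [set w | exists x t, [/\ A x, 0 <= t & w = x + t *: v]].
  apply: nAv; apply: (Amax B).
  - by move=> x Ax; exists x, 0; rewrite scale0r addr0.
  - split.
    + move=> _ _ [x [s [Ax s0 ->]]] [y [t [Ay t0 ->]]].
      by exists (x + y), (s + t); split; [exact: AD|lra|lmod R].
    + move=> t _ t0 [x [s [Ax s0 ->]]].
      by exists (t *: x), (t * s); split; [exact: AZ|rewrite mulr_ge0// ltW|lmod R].
    + by exists 0, 0; rewrite scale0r addr0.
    + move=> [x [t [Ax t0 kE]]]; have [t00|t_neq0] := eqVneq t 0.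
        by apply: Ank; rewrite kE t00 scale0r addr0.
      apply: nANv; have -> : - v = t^-1 *: (x + k).
        by rewrite -[k]opprK kE; lmod R.
      by apply: AZ; [rewrite invr_gt0 lt_def t_neq0|exact: AD].
    + by move=> x /NA Ax; exists x, 0; rewrite scale0r addr0.
  - by exists 0, 1; split => //; rewrite scale1r add0r.
(* The functional is the infimum of these sets. The infimum need not be attained, hence the margins
   [e] below. *)
pose U v : set R := [set t | A (t *: k - v)].
have infU v : has_inf (U v).
  split.
    by have [t] := absN (- v); rewrite addrC => /NA; exists t.
  have [u /NA Au] := absN v; exists (- u) => t /= /AD /(_ Au).
  have -> : t *: k - v + (v + u *: k) = (t + u) *: k by lmod R.
  by move=> /Ak_ge0; lra.
pose l v := inf (U v).
have l_le v t : A (t *: k - v) -> l v <= t.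
  by move=> At; apply: ge_inf => //; case: (infU v).
have le_l v t : A (v - t *: k) -> t <= l v.
  move=> At; apply: lb_le_inf => [|u /= /AD /(_ At)]; first by case: (infU v).
  have -> : u *: k - v + (v - t *: k) = (u - t) *: k by lmod R.
  by move=> /Ak_ge0; lra.
have lt_l v e : 0 < e -> A ((l v + e) *: k - v).
  move=> e0; have [u Au ue] := inf_adherent e0 (infU v).
  have -> : (l v + e) *: k - v = (u *: k - v) + (l v + e - u) *: k by lmod R.
  by apply: Ak_up => //; rewrite /l; lra.
have l_lt v e : 0 < e -> A (v - (l v - e) *: k).
  move=> e0; have [/l_le|] := total ((l v - e) *: k - v); first lra.
  by rewrite opprB.
have lD u v : l (u + v) = l u + l v.
  apply/eqP; rewrite eq_le; apply/andP; split; apply/ler_addgt0Pr => e e0.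
    apply: l_le.
    have -> : (l u + l v + e) *: k - (u + v) =
      ((l u + e / 2) *: k - u) + ((l v + e / 2) *: k - v) by lmod R.
    by apply: AD; apply: lt_l; lra.
  rewrite -lerBlDr; apply: le_l.
  have -> : u + v - (l u + l v - e) *: k =
    (u - (l u - e / 2) *: k) + (v - (l v - e / 2) *: k) by lmod R.
  by apply: AD; apply: l_lt; lra.
have l0 : l 0 = 0 by have := lD 0 0; rewrite addr0; lra.
have lN v : l (- v) = - l v by have := lD v (- v); rewrite subrr l0; lra.
have lZ_gt0 t v : 0 < t -> l (t *: v) = t * l v.
  move=> t0; apply/eqP; rewrite eq_le; apply/andP; split; apply/ler_addgt0Pr => e e0.
    apply: l_le.
    have -> : (t * l v + e) *: k - t *: v = t *: ((l v + e / t) *: k - v).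
      by lmod R; field; lra.
    by apply: AZ => //; apply: lt_l; rewrite divr_gt0.
  rewrite -lerBlDr; apply: le_l.
  have -> : t *: v - (t * l v - e) *: k = t *: (v - (l v - e / t) *: k).
    by lmod R; field; lra.
  by apply: AZ => //; apply: l_lt; rewrite divr_gt0.
exists l; split.
- move=> t u v; rewrite lD; congr (_ + _).
  have [t0|t0|->] := ltgtP t 0; last by rewrite scale0r l0 mul0r.
    by rewrite -[t *: u]opprK -scaleNr lN lZ_gt0 ?oppr_gt0// mulNr opprK.
  exact: lZ_gt0.
- apply/eqP; rewrite eq_le l_le ?le_l//; by rewrite scale1r subrr.
- by move=> x /NA Ax; apply: le_l; rewrite scale0r subr0.
Qed.


End Separation.
End ConvexSets.

(** * Neighbourhoods and interiors of cones *)

Section TopologicalVectorSpaces.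
Context {R : realType} {V : tvsType R}.
Implicit Types (U A : set V).

Lemma nbhs_line U a v :
  nbhs a U -> exists2 e : R, 0 < e & forall t, `|t| <= e -> U (a + t *: v).
Proof.
move=> aU; have := nbhsB (- a) aU; rewrite addNr => U0.
have := @scale_continuous R V (0, v); rewrite /continuous_at/= scale0r.
move=> /(_ _ U0)[]/= B [/nbhs_ballP[e/= e0 eB] /nbhs_singleton Bv] BU.
exists (e / 2) => [|t te]; first by rewrite divr_gt0.
have /BU/= : (B.1 `*` B.2) (t, v).
  by split => //; apply: eB; rewrite /ball/= sub0r normrN; lra.
by case=> u Uu <-; rewrite addrA subrr add0r.
Qed.

Lemma nbhs_absorb U v : nbhs 0 U -> exists2 e : R, 0 < e & U (e *: v).
Proof.
move=> /(@nbhs_line _ _ v)[e e0 eU]; exists e => //.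
by rewrite -[_ *: _]add0r; apply: eU; rewrite gtr0_norm.
Qed.

Lemma convex_nbhs U : nbhs 0 U ->
  exists B, [/\ nbhs 0 B, B `<=` U & convex_set B].
Proof.
move=> U0; have [F Fconv [Fopen /(_ 0 _ U0)[B [FB B0] BU]]] := @locally_convex R V.
exists B; split=> //; last exact: Fconv _ (mem_set FB).
by apply: open_nbhs_nbhs; split=> //; exact: Fopen.
Qed.

Lemma interior_coneZ A t x : convex_cone A -> 0 < t -> A^° x -> A^° (t *: x).
Proof.
move=> [_ coneA] t0 Ax; have t_neq0 : t != 0 by rewrite gt_eqF.
by apply: filterS (nbhsZ t_neq0 Ax) => _ [y Ay <-]; exact: coneA.
Qed.

Lemma interior_coneD A x y : convex_cone A -> A^° x -> A y -> A^° (x + y).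
Proof.
move=> coneA Ax Ay; rewrite addrC.
by apply: filterS (nbhsB y Ax) => _ [z Az <-]; exact: convex_coneD.
Qed.

(** The points [e *: x] of the cone approach the origin as [e] decreases to 0. *)
Lemma closed_cone0 A : closed A -> convex_cone A -> A !=set0 -> A 0.
Proof.
move=> clA [_ coneA] [x Ax]; apply: clA => B /(@nbhs_absorb _ x)[e e0 Bex].
by exists (e *: x); split=> //; exact: coneA.
Qed.

Lemma proper_cone_interior0 A : convex_cone A -> A <> setT -> ~ A^° 0.
Proof.
move=> [_ coneA] AT A0; apply: AT; rewrite -subTset => x _.
have [e e0 Aex] := @nbhs_absorb _ x A0.
have -> : x = e^-1 *: (e *: x) by have ? := lt0r_neq0 e0; lmod R.
by apply: coneA; rewrite // invr_gt0.
Qed.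

Lemma interior_line A x v :
  A^° x -> exists2 e : R, 0 < e & forall t, `|t| <= e -> A^° (x + t *: v).
Proof. by move=> Ax; apply: nbhs_line; exact: nbhs_interior. Qed.

Lemma interior_cone_absorb A x v : convex_cone A -> A^° x ->
  exists2 t0 : R, 0 < t0 & forall t, t0 <= t -> A^° (v + t *: x).
Proof.
move=> coneA Ax; have [e e0 Axv] := interior_line v Ax.
exists e^-1 => [|t et]; first by rewrite invr_gt0.
have t0 : 0 < t by apply: lt_le_trans et; rewrite invr_gt0.
have -> : v + t *: x = t *: (x + t^-1 *: v) by have ? := lt0r_neq0 t0; lmod R.
apply: interior_coneZ => //; apply: Axv.
by rewrite gtr0_norm ?invr_gt0// invf_ple.
Qed.

End TopologicalVectorSpaces.

(** * Scalar functionals and rank-one operators *)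

Section Functionals.
Context {R : realType} {V : lmodType R}.
Variable p : V -> R.
Hypothesis lin_p : scalar p.

Lemma functional0 : p 0 = 0.
Proof. by have := lin_p (-1) 0 0; rewrite scaler0 addr0; lra. Qed.

Lemma functionalN v : p (- v) = - p v.
Proof. by have := lin_p (-1) v 0; rewrite addr0 scaleN1r functional0; lra. Qed.

Lemma functionalZ t v : p (t *: v) = t * p v.
Proof. by have := lin_p t v 0; rewrite !addr0 functional0 addr0. Qed.

Lemma functionalD u v : p (u + v) = p u + p v.
Proof. by have := lin_p 1 u v; rewrite scale1r mul1r. Qed.

Lemma functionalB u v : p (u - v) = p u - p v.
Proof. by rewrite functionalD functionalN. Qed.

End Functionals.

Section RankOne.
Context {R : realType} {V Y : tvsType R}.
Variables (p : V -> R) (k : Y).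
Hypothesis lin_p : scalar p.

Definition rank_one_fun (v : V) : Y := p v *: k.

Lemma rank_one_fun_is_linear : linear rank_one_fun.
Proof. by move=> t u v; rewrite /rank_one_fun lin_p scalerDl scalerA. Qed.

Lemma rank_one_subproof : exists T : {linear V -> Y}, forall v, T v = p v *: k.
Proof.
pose T := GRing.isLinear.Build R V Y *:%R rank_one_fun rank_one_fun_is_linear.
pose f : {linear V -> Y} := HB.pack rank_one_fun T.
by exists f.
Qed.

(** The one-sided bound on [U] becomes two-sided on the intersection of [U] and [- U]; scaling by
    [e / d] then keeps [p v *: k] within the segment allowed by [A]. Adding 1 to [|c|] makes [d]
    positive. *)
Lemma continuous_rank_one (U : set V) c :
  nbhs 0 U -> (forall v, U v -> p v <= c) -> continuous (fun v => p v *: k).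
Proof.
move=> U0 pc x A /(@nbhs_line _ _ _ _ k)[e e0 Ae].
pose d := `|c| + 1; have d0 : 0 < d by rewrite ltr_pwDr.
have ed0 : e / d != 0 by rewrite gt_eqF ?divr_gt0.
have UN0 : nbhs 0 (U `&` (-%R @` U)) by apply: filterI => //; exact: nbhs0N.
apply: filterS (nbhsT x (nbhs0Z ed0 UN0)) => _ [_ [v [Uv [w Uw wv]] <-] <-] /=.
rewrite (functionalD lin_p) (functionalZ lin_p) scalerDl; apply: Ae.
have pvd : `|p v| <= d.
  have := pc _ Uv; have := pc _ Uw; have := ler_norm c.
  by rewrite -wv (functionalN lin_p) ler_norml /d; lra.
rewrite normrM gtr0_norm ?divr_gt0// -[leRHS](divfK (lt0r_neq0 d0)).
by rewrite ler_wpM2l// ltW// divr_gt0.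
Qed.

Lemma rank_one (U : set V) c : nbhs 0 U -> (forall v, U v -> p v <= c) ->
  exists2 T : {linear V -> Y}, continuous T & forall v, T v = p v *: k.
Proof.
move=> U0 pc; have [T TE] := rank_one_subproof; exists T => //.
by rewrite (_ : (T : V -> Y) = fun v => p v *: k);
  [exact: continuous_rank_one pc|exact/funext].
Qed.

End RankOne.

(** * Weak suprema *)

Section WeakSupremum.
Context {R : realType} {Y : tvsType R}.
Variable K : set Y.
Hypotheses (K_closed : closed K) (K_cone : convex_cone K).
Hypothesis K_int : K^° !=set0.
Implicit Types (u v w : \bar Y) (M N : set (\bar Y)) (y k : Y).

Lemma opp_setE (V : zmodType) (A : set V) x : opp_set A x <-> A (- x).
Proof.
split; first by move=> [a Aa <-]; rewrite opprK.
by move=> Ax; exists (- x); rewrite ?opprK.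
Qed.

Lemma ltK_fin y1 y2 : ltK K y1%:E y2%:E <-> K^° (y2 - y1).
Proof. by rewrite /ltK opp_setE opprB. Qed.

Lemma leK_fin y1 y2 : leK K y1%:E y2%:E <-> K (y2 - y1).
Proof. by rewrite /leK opp_setE opprB. Qed.

Lemma K0 : K 0.
Proof.
by apply: closed_cone0 => //; case: K_int => x /interior_subset Kx; exists x.
Qed.

Lemma ltKW u v : ltK K u v -> leK K u v.
Proof.
by case: u v => [u| |] [v| |]// /ltK_fin /interior_subset /leK_fin.
Qed.

Lemma leK_refl u : leK K u u.
Proof. by case: u => [u| |]//; rewrite leK_fin subrr; exact: K0. Qed.

Lemma leK_ltK_trans v u w : leK K u v -> ltK K v w -> ltK K u w.
Proof.
case: u v w => [u| |] [v| |] [w| |] //; rewrite leK_fin !ltK_fin => Kvu Kwv.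
have -> : w - u = (w - v) + (v - u) by lmod R.
exact: interior_coneD.
Qed.

Lemma ltK_leK_trans v u w : ltK K u v -> leK K v w -> ltK K u w.
Proof.
case: u v w => [u| |] [v| |] [w| |] //; rewrite leK_fin !ltK_fin => Kvu Kwv.
have -> : w - u = (v - u) + (w - v) by lmod R.
exact: interior_coneD.
Qed.

Lemma ltK_trans v u w : ltK K u v -> ltK K v w -> ltK K u w.
Proof. by move=> /ltKW; exact: leK_ltK_trans. Qed.

Lemma ext_oppK u : (- - u)%E = u.
Proof. by case: u => [u| |]//=; rewrite opprK. Qed.

Lemma ext_addr0 u : (u + 0%:E)%E = u.
Proof. by case: u => [u| |]//; congr (_%:E); exact: addr0. Qed.

Lemma ltKN u v : ltK K (- u)%E (- v)%E <-> ltK K v u.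
Proof.
case: u v => [u| |] [v| |]//; rewrite !ltK_fin.
by rewrite (_ : - v - - u = u - v)//; lmod R.
Qed.

Lemma ltK_add u u' v v' :
  ltK K u u' -> ltK K v v' -> ltK K (u + v)%E (u' + v')%E.
Proof.
case: u u' v v' => [u| |] [u'| |] [v| |] [v'| |]//.
rewrite !ltK_fin => Kuu' Kvv'.
have -> : u' + v' - (u + v) = (u' - u) + (v' - v) by lmod R.
by apply: interior_coneD => //; exact: interior_subset.
Qed.

(** This interpolation makes [lower] of a sum of sets depend only on the [lower] of each summand. A
    finite gap is shared equally; next to an infinite summand, the free one absorbs the
    difference. *)
Lemma ltK_split w u v : ltK K w (u + v)%E ->
  exists u' v', [/\ ltK K u' u, ltK K v' v & leK K w (u' + v')%E].
Proof.
have [k Kk] := K_int.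
have ltBk y : ltK K (y - k)%:E y%:E by rewrite ltK_fin subKr.
have le_sum (a b c : Y) : a + b = c -> leK K c%:E (a%:E + b%:E)%E.
  by move=> <-; exact: leK_refl.
case: u v => [u| |] [v| |]; case: w => [w| |]//.
- move=> /ltK_fin Kw; pose d := 2%:R^-1 *: (u + v - w).
  have Kd : K^° d by apply: interior_coneZ => //; lra.
  exists (u - d)%:E, (v - d)%:E; split; try by apply/ltK_fin; rewrite subKr.
  by apply: le_sum; rewrite /d; lmod R.
- by exists (u - k)%:E, (v - k)%:E; split.
- by exists (u - k)%:E, (w - (u - k))%:E; split=> //; apply: le_sum; lmod R.
- by exists (u - k)%:E, 0%:E.
- by exists (w - (v - k))%:E, (v - k)%:E; split=> //; apply: le_sum; lmod R.
- by exists 0%:E, (v - k)%:E.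
- by exists w%:E, 0%:E; split=> //; apply: le_sum; lmod R.
- by exists 0%:E, 0%:E.
Qed.

Definition lower M : set (\bar Y) := [set w | exists2 u, M u & ltK K w u].

Lemma ltK_lower v w M : ltK K w v -> lower M v -> lower M w.
Proof. by move=> wv [u Mu vu]; exists u => //; exact: ltK_trans vu. Qed.

Lemma WSup_lower M v :
  WSup K M v <-> ~ lower M v /\ (forall w, ltK K w v -> lower M w).
Proof.
split=> -[Mv Mw]; split=> //; first by move=> [u /Mv].
by move=> u Mu vu; apply: Mv; exists u.
Qed.

Lemma eq_WSup M N : lower M = lower N -> WSup K M = WSup K N.
Proof. by move=> MN; apply/seteqP; split=> v; rewrite !WSup_lower MN. Qed.

Lemma lower_open M y k :
  lower M y%:E -> exists2 e : R, 0 < e & lower M (y + e *: k)%:E.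
Proof.
move=> [[u| |] Mu]//; last by exists 1 => //; exists +oo%E.
rewrite ltK_fin => /interior_line-/(_ (- k))[e e0 Ke]; exists e => //.
exists u%:E => //; rewrite ltK_fin.
have -> : u - (y + e *: k) = u - y + e *: (- k) by lmod R.
by apply: Ke; rewrite gtr0_norm.
Qed.

Lemma lower_fin M w : lower M w -> exists y, lower M y%:E.
Proof.
have [k Kk] := K_int; move=> [[u| |] Mu wu]; last by case: w wu.
  by exists (u - k), u%:E; rewrite // ltK_fin subKr.
by exists 0, +oo%E.
Qed.

Lemma lower_ninfty M w : lower M w -> lower M -oo%E.
Proof. by move=> [[u| |] Mu wu]; [exists u%:E|exists +oo%E|case: w wu]. Qed.

(** Along an interior direction, membership in [lower M] is inherited by smaller parameters and is
    open upwards, so the supremum of the admissible parameters is not attained and marks a weak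
    supremum. *)
Lemma WSup_line M y k (t1 t2 : R) : K^° k ->
  lower M (y + t1 *: k)%:E -> ~ lower M (y + t2 *: k)%:E ->
  exists2 t, t1 < t <= t2 & WSup K M (y + t *: k)%:E.
Proof.
move=> Kk lt1 nlt2; pose A : set R := [set t | lower M (y + t *: k)%:E].
have le_line s t : s < t -> ltK K (y + s *: k)%:E (y + t *: k)%:E.
  move=> st; rewrite ltK_fin.
  have -> : y + t *: k - (y + s *: k) = (t - s) *: k by lmod R.
  by apply: interior_coneZ => //; rewrite subr_gt0.
have A_le t : A t -> t <= t2.
  move=> At; rewrite leNgt; apply/negP => t2t; apply: nlt2.
  exact: ltK_lower (le_line _ _ t2t) At.
have supA : has_sup A by split; [exists t1|exists t2].
have A_lt t : A t -> t < sup A.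
  move=> /(lower_open k)[e e0 At]; apply: (@lt_le_trans _ _ (t + e)); first lra.
  by apply: sup_upper_bound => //; rewrite /A/= scalerDl addrA.
exists (sup A).
  by rewrite A_lt//= ge_sup//; exists t1.
apply/WSup_lower; split; first by move/A_lt; rewrite ltxx.
case=> [w| |]//; last by move=> _; exact: lower_ninfty lt1.
(* The strict gap to [w] survives a step back by [e *: k], and some admissible parameter exceeds
   [sup A - e]. *)
rewrite ltK_fin => /interior_line-/(_ (- k))[e e0 Ke].
have [t At et] := sup_adherent e0 supA.
apply: ltK_lower At; apply: ltK_trans (le_line _ _ et); rewrite ltK_fin.
have -> : y + (sup A - e) *: k - w = y + sup A *: k - w + e *: (- k) by lmod R.
by apply: Ke; rewrite gtr0_norm.
Qed.

Lemma WSup_pinfty M : (forall y, lower M y%:E) -> WSup K M = [set +oo%E].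
Proof.
move=> My; apply/seteqP; split=> [[v| |] /WSup_lower[nMv _]//|_ ->].
- by case: (nMv (lower_ninfty (My 0))).
- apply/WSup_lower; split; first by case.
  by case=> [w| |]// _; exact: lower_ninfty (My 0).
Qed.

(** For the inclusion of [lower M], follow the line from [w0] towards [u] until it leaves [lower M].
    It must leave, because it eventually passes strictly above a point [y1] outside; if there is no
    such point, the weak supremum is +oo. *)
Lemma lower_WSup M : lower (WSup K M) = lower M.
Proof.
apply/seteqP; split=> w [u]; first by move=> /WSup_lower[_ +] wu => /(_ _ wu).
move=> Mu wu; have [My|/existsNP[y1 ny1]] := pselect (forall y, lower M y%:E).
  by exists +oo%E; [rewrite WSup_pinfty|case: w wu].
case: u Mu wu => [u| |] Mu wu; [|by case: ny1; exists +oo%E|by case: w wu].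
suff main (w0 : Y) : ltK K w0%:E u%:E -> lower (WSup K M) w0%:E.
  case: w wu => [w| |]//; first exact: main.
  have [k Kk] := K_int; have /main : ltK K (u - k)%:E u%:E.
    by rewrite ltK_fin subKr.
  by move=> + _; exact: lower_ninfty.
move=> w0u; have := w0u; rewrite ltK_fin => Kk.
have [t0 _ /(_ _ (lexx _)) Kt0] := interior_cone_absorb (w0 - y1) K_cone Kk.
have [||t /andP[t_gt0 _] Mt] := @WSup_line M w0 _ 0 t0 Kk.
- by rewrite scale0r addr0; exists u%:E.
- apply: contra_not ny1; apply: ltK_lower.
  by rewrite ltK_fin addrAC.
- exists (w0 + t *: (u - w0))%:E => //; rewrite ltK_fin addrAC subrr add0r.
  exact: interior_coneZ.
Qed.

Definition sumset M N : set (\bar Y) := [set (u + v)%E | u in M & v in N].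

Lemma mem_sumset M N u v : M u -> N v -> sumset M N (u + v)%E.
Proof. by move=> Mu Nv; exists u => //; exists v. Qed.

Lemma sub_lower_sumset M M' N N' : lower M `<=` lower M' ->
  lower N `<=` lower N' -> lower (sumset M N) `<=` lower (sumset M' N').
Proof.
move=> MM' NN' w [_ [u Mu [v Nv <-]]] /ltK_split[u' [v' [uu' vv' wuv']]].
have [|a M'a u'a] := MM' u'; first by exists u.
have [|b N'b v'b] := NN' v'; first by exists v.
exists (a + b)%E; first by exists a => //; exists b.
exact: leK_ltK_trans wuv' (ltK_add u'a v'b).
Qed.

Lemma lower_sumset M M' N N' : lower M = lower M' -> lower N = lower N' ->
  lower (sumset M N) = lower (sumset M' N').
Proof.
by move=> MM' NN'; apply/seteqP; split; apply: sub_lower_sumset; rewrite ?MM' ?NN'.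
Qed.

Lemma uplus_WSup M N : uplus K (WSup K M) (WSup K N) = WSup K (sumset M N).
Proof. by apply: eq_WSup; apply: lower_sumset; exact: lower_WSup. Qed.

(** The order-theoretic core of duality: the first hypothesis is weak duality for the dual values
    [T], the second is attainment of every point of the weak infimum. *)
Lemma WInf_eq_WMax (M T : set (\bar Y)) :
  (forall u, T u -> ~ lower (-%E @` M) (- u)%E) ->
  (forall v, WSup K (-%E @` M) v -> T (- v)%E) ->
  WInf K M = WMax K T.
Proof.
rewrite /WInf /WMax; move: (-%E @` M) => {M} M weak strong.
(* Descend from [w] along [- k] until the line enters [lower M]; the entry point is a weak supremum.
   If nothing is in [lower M], then -oo is one. *)
have cut v w : ltK K w v -> ~ lower M w -> exists2 v1, WSup K M v1 & ltK K v1 v.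
  have [k Kk] := K_int.
  move=> wv nMw; have [Moo|nMoo] := pselect (lower M -oo%E); last first.
    exists -oo%E; last by case: v w wv nMw => [v| |] [].
    by apply/WSup_lower; split=> // -[].
  case: w wv nMw => [w| |] wv nMw; [|by case: v wv|by []].
  have [y My] := lower_fin Moo.
  have [t0 _ /(_ _ (lexx _)) Kt0] := interior_cone_absorb (y - w) K_cone Kk.
  have [||t /andP[_ t_le0] Mt] := @WSup_line M w _ (- t0) 0 Kk.
  - apply: ltK_lower My; rewrite ltK_fin.
    by rewrite (_ : _ - _ = y - w + t0 *: k)//; lmod R.
  - by rewrite scale0r addr0.
  - exists (w + t *: k)%:E => //; apply: leK_ltK_trans wv.
    rewrite leK_fin (_ : _ - _ = - t *: k); last by lmod R.
    have [->|t_neq0] := eqVneq t 0; first by rewrite oppr0 scale0r; exact: K0.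
    apply: (proj2 K_cone); last exact: interior_subset.
    by rewrite oppr_gt0 lt_neqAle t_neq0.
apply/seteqP; split=> [_ [v Mv <-]|y [Ty /WSup_lower[yT _]]].
  split; first exact: strong.
  apply/WSup_lower; split=> [[u Tu vu]|w wv]; last first.
    by exists (- v)%E => //; exact: strong.
  apply: (weak _ Tu); have /WSup_lower[_] := Mv; apply.
  by apply/ltKN; rewrite ext_oppK.
exists (- y)%E; last by rewrite ext_oppK.
apply/WSup_lower; split; first exact: weak.
move=> w wy; apply: contrapT => /(cut _ _ wy)[v1 Mv1 v1y].
apply: yT; exists (- v1)%E; first exact: strong.
by apply/ltKN; rewrite ext_oppK.
Qed.

End WeakSupremum.

(** * Separation relative to a subspace *)

Lemma nonneg_slope (R : realType) (a b : R) :
  (forall t, 0 < t -> 0 <= a + t * b) -> 0 <= b.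
Proof.
move=> ab; rewrite leNgt; apply/negP => b0.
have t0 : 0 < (`|a| + 1) / - b by rewrite divr_gt0 ?oppr_gt0// ltr_pwDr.
have := ab _ t0; rewrite invrN mulrN mulNr divfK ?lt_eqF//.
by have := ler_norm a; lra.
Qed.

Lemma nonneg_limit (R : realType) (a b : R) :
  (forall t, 0 < t -> 0 <= a + t * b) -> 0 <= a.
Proof.
move=> ab; apply: (@nonneg_slope _ b) => t t0.
have ti0 : 0 < t^-1 by rewrite invr_gt0.
have := mulr_ge0 (ltW t0) (ab _ ti0).
by rewrite mulrDr mulrA divff ?mul1r ?lt0r_neq0// addrC.
Qed.

Section PositiveFunctionals.
Context {R : realType} {Y : tvsType R}.
Variables (K : set Y) (l : Y -> R) (k : Y).
Hypotheses (lin_l : scalar l) (lK : forall y, K y -> 0 <= l y) (lk : l k = 1).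

Lemma positive_functional_interior y : K^° y -> 0 < l y.
Proof.
move=> /(interior_line (- k))[e e0 Ky].
have : 0 <= l (y + e *: - k).
  by apply: lK; apply: interior_subset; apply: Ky; rewrite gtr0_norm.
by rewrite (functionalD lin_l) (functionalZ lin_l) (functionalN lin_l) lk; lra.
Qed.

End PositiveFunctionals.

Section RelativeSeparation.
Context {R : realType} {U Y : tvsType R}.
Variables (K : set Y) (k : Y).
Hypotheses (K_cone : convex_cone K) (K_0 : K 0) (Kk : K^° k).
Variables (E : set (U * Y)) (Z B : set U) (d : Y).
Hypotheses (convE : convex_set E) (E0 : ~ E (0, 0)).
Hypothesis upE : forall u y q, K q -> E (u, y) -> E (u, y + q).
Hypothesis EZ : forall u y, E (u, y) -> Z u.
Hypothesis (Z0 : Z 0) (ZZ : forall t u, Z u -> Z (t *: u)).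
Hypotheses (nbhsB0 : nbhs 0 B) (convB : convex_set B).
Hypothesis BE : forall u, B u -> Z u -> E (u, d).

(* Adding the cone over [B * {d}] makes [E] absorbing in the direction [k]
   beyond [Z], while keeping the origin out. *)
Let N : set (U * Y) := [set q | exists u y s b,
  [/\ E (u, y), 0 <= s, B b & q = (u + s *: b, y + s *: d)]].

Let B0 : B 0. Proof. exact: nbhs_singleton. Qed.

Let Ek t : 0 <= t -> K (t *: k).
Proof.
rewrite le_eqVlt => /predU1P[<-|t0]; first by rewrite scale0r.
by apply: (proj2 K_cone) => //; exact: interior_subset.
Qed.

Let convN : convex_set N.
Proof.
apply: convex_setI_strict => t q1 q2 /andP[t0 t1].
move=> [u1 [y1 [s1 [b1 [E1 s10 Bb1 ->]]]]] [u2 [y2 [s2 [b2 [E2 s20 Bb2 ->]]]]].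
have t01 : 0 <= t <= 1 by rewrite !ltW.
have r0 : 0 < 1 - t by lra.
have ts1 : 0 <= t * s1 by rewrite mulr_ge0// ltW.
have rs2 : 0 <= (1 - t) * s2 by rewrite mulr_ge0// ltW.
pose s := t * s1 + (1 - t) * s2.
exists (t *: u1 + (1 - t) *: u2), (t *: y1 + (1 - t) *: y2), s.
(* With total weight [s] zero the conical parts vanish; otherwise [b1] and [b2] are mixed with their
   shares of [s]. *)
have [s0|s_neq0] := eqVneq s 0.
  have ts10 : t * s1 = 0 by move: s0; rewrite /s; lra.
  have rs20 : (1 - t) * s2 = 0 by move: s0; rewrite /s; lra.
  exists b1; split => //.
  - exact: (convex_combination convE t01 E1 E2).
  - by rewrite s0.
  - by congr (_, _); rewrite /= s0 !scalerDr !scalerA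
      ts10 rs20 !scale0r !addr0.
have s_gt0 : 0 < s by rewrite lt_def s_neq0 addr_ge0.
exists ((t * s1 / s) *: b1 + (1 - t * s1 / s) *: b2); split.
- exact: (convex_combination convE t01 E1 E2).
- exact: ltW.
- apply: convex_combination => //.
  by rewrite divr_ge0 ?(ltW s_gt0)//= ler_pdivrMr// mul1r lerDl.
- have tsE : 1 - t * s1 / s = (1 - t) * s2 / s.
    apply: (mulIf s_neq0); rewrite mulrBl !divfK// mul1r.
    by rewrite /s addrAC subrr add0r.
  rewrite tsE; congr (_, _); rewrite /=.
    by lmod R.
  by rewrite /s; lmod R.
Qed.

Let N0 : ~ N 0.
Proof.
move=> [u [y [s [b [Euy s0 Bb [uE yE]]]]]].
have [s00|s_neq0] := eqVneq s 0.
  by apply: E0; move: uE yE Euy; rewrite s00 !scale0r !addr0 => <- <-.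
have s_gt0 : 0 < s by rewrite lt_def s_neq0.
have us : u = - s *: b by apply/eqP; rewrite scaleNr -subr_eq0 opprK -uE.
have ys : y = - s *: d by apply/eqP; rewrite scaleNr -subr_eq0 opprK -yE.
(* Here [b] is a negative multiple of [u], hence in [Z], so [(b, d)] belongs to [E]. The origin is
   then a convex combination of [(u, y)] and [(b, d)], contradicting [E0]. *)
have Zb : Z b.
  have -> : b = (- s^-1) *: u by rewrite us; lmod R.
  exact: ZZ (EZ Euy).
have s1 : 0 < 1 + s by lra.
have s1_neq0 := lt0r_neq0 s1.
have t01 : 0 <= (1 + s)^-1 <= 1.
  by rewrite invr_ge0 ltW//= invf_le1// lerDl.
have := convex_combination convE t01 Euy (BE Bb Zb).
suff -> : (1 + s)^-1 *: (u, y) + (1 - (1 + s)^-1) *: (b, d) = (0, 0) by [].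
by rewrite us ys; congr (_, _); rewrite /=; lmod R.
Qed.

Let absN q : exists t, N (q + t *: ((0, k) : U * Y)).
Proof.
case: q => u y; have [e e0 Beu] := nbhs_absorb u nbhsB0.
have e_neq0 := lt0r_neq0 e0.
have [t _ /(_ _ (lexx _)) /interior_subset Kt] :=
  interior_cone_absorb (y - d - e^-1 *: d) K_cone Kk.
(* The direction [u] comes entirely from the added cone, over the base point [(0, d)] of [E]; [t]
   only has to lift the last component. *)
exists t, 0, (d + (y - d - e^-1 *: d + t *: k)), e^-1, (e *: u); split=> //.
- by apply: upE => //; exact: BE.
- by rewrite invr_ge0 ltW.
- by congr (_, _); rewrite /=; lmod R.
Qed.

Lemma relative_separation : exists (a : U -> R) (l : Y -> R),
  [/\ scalar a, scalar l, l k = 1, forall y, K y -> 0 <= l y &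
  (forall u y, E (u, y) -> a u <= l y) /\ (forall u, B u -> a u <= l d)].
Proof.
have upN q t : 0 <= t -> N q -> N (q + t *: ((0, k) : U * Y)).
  move=> t0 [u [y [s [b [Euy s0 Bb ->]]]]].
  exists u, (y + t *: k), s, b; split=> //; first by apply: upE => //; exact: Ek.
  by congr (_, _); rewrite /=; lmod R.
have [m [lin_m mk Nm]] := separation convN N0 upN absN.
have mE u y : m (u, y) = m (u, 0) + m (0, y).
  rewrite -(functionalD lin_m); congr m; congr (_, _); rewrite /=.
    by rewrite addr0.
  by rewrite add0r.
have Em u y : E (u, y) -> 0 <= m (u, 0) + m (0, y).
  move=> Euy; rewrite -mE; apply: Nm; exists u, y, 0, 0.
  by rewrite !scale0r !addr0; split.
have Ed : E (0, d) by exact: BE.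
have m0 : m (0, 0) = 0 by exact: (functional0 lin_m).
exists (fun u => - m (u, 0)), (fun y => m (0, y)); split => //.
- move=> t u v /=.
  have -> : (t *: u + v, 0 : Y) = t *: (u, 0) + (v, 0).
    by congr (_, _); rewrite /= scaler0 addr0.
  by rewrite lin_m /= opprD mulrN.
- move=> t u v /=.
  have -> : (0 : U, t *: u + v) = t *: (0, u) + (0, v).
    by congr (_, _); rewrite /= scaler0 addr0.
  exact: lin_m.
- move=> y Ky; apply: (@nonneg_slope _ (m (0, d))) => t t0.
  rewrite -(functionalZ lin_m) -(functionalD lin_m).
  have := Em _ _ (upE (proj2 K_cone _ _ t0 Ky) Ed); rewrite m0 add0r.
  by congr (0 <= m _); congr (_, _); rewrite /= scaler0 addr0.
- split=> [u y /Em|u Bu]; first lra.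
  suff : 0 <= m (u, 0) + m (0, d) by lra.
  (* Points of [B] enter [N] with arbitrarily large weight [t], which bounds [a] on all of [B] and
     not only on [Z]. *)
  apply: (@nonneg_slope _ (m (0, d))) => t t0.
  rewrite -mE -(functionalZ lin_m) -(functionalD lin_m); apply: Nm.
  by exists 0, d, t, u; split; rewrite // ltW.
Qed.

End RelativeSeparation.

(** * Duality *)

Lemma cone_convexP (R : realType) (V U : lmodType R) (Q : set U)
    (E : V -> option U) t x1 x2 e1 e2 q1 q2 :
  cone_convex Q E -> 0 <= t <= 1 ->
  E x1 = Some e1 -> Q q1 -> E x2 = Some e2 -> Q q2 ->
  exists e q, [/\ E (t *: x1 + (1 - t) *: x2) = Some e, Q q &
    t *: (e1 + q1) + (1 - t) *: (e2 + q2) = e + q].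
Proof.
move=> convE t01 E1 Q1 E2 Q2.
have [||e /= Ee [q Qq eq]] :=
  @convex_combination R _ _ t (x1, e1 + q1) (x2, e2 + q2) convE t01.
- by exists e1 => //; exists q1.
- by exists e2 => //; exists q2.
- by exists e, q.
Qed.

Section LinearHull.
Context {R : realType} {V : lmodType R}.
Implicit Type A : set V.

Lemma sub_lin A : A `<=` lin A.
Proof. by move=> x Ax B [_]; apply. Qed.

Lemma lin0 A : lin A 0.
Proof. by move=> B [[B0 _] _]; exact: set_mem. Qed.

Lemma linP A t x y : lin A x -> lin A y -> lin A (t *: x + y).
Proof.
move=> Ax Ay B BA; have [[_ linB] _] := BA; apply: set_mem.
by apply: linB; apply: mem_set; [exact: Ax|exact: Ay].
Qed.

Lemma linZ A t x : lin A x -> lin A (t *: x).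
Proof. by move=> Ax; rewrite -[_ *: _]addr0; apply: linP => //; exact: lin0. Qed.

Lemma linB A x y : lin A x -> lin A y -> lin A (x - y).
Proof.
by move=> Ax Ay; rewrite addrC -scaleN1r; exact: linP.
Qed.

End LinearHull.

Lemma nbhs_pair0 (R : realType) (V V' : tvsType R) (B : set (V * V')) :
  nbhs (0, 0) B -> nbhs 0 [set v | B (v, 0)] /\ nbhs 0 [set v | B (0, v)].
Proof.
move=> [[B1 B2] /= [B10 B20] B12]; split.
  by apply: filterS B10 => v B1v; apply: B12; split=> //; exact: nbhs_singleton.
by apply: filterS B20 => v B2v; apply: B12; split=> //; exact: nbhs_singleton.
Qed.

Section StrongDuality.
Context {R : realType} {X Y Z W : tvsType R}.
Variables (K : set Y) (P : set W) (S : set Z).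
Hypotheses (K_proper : K <> setT) (K_closed : closed K) (K_cone : convex_cone K).
Hypothesis K_int : K^° !=set0.
Hypotheses (P_cone : convex_cone P) (P_nonempty : P !=set0).
Hypotheses (S_cone : convex_cone S) (S_nonempty : S !=set0).
Variables (F : X -> option Y) (kappa : W -> option Y).
Variables (H : X -> option W) (G : X -> option Z) (C : set X).
Hypotheses (F_convex : cone_convex K F) (H_convex : cone_convex P H).
Hypotheses (G_convex : cone_convex S G) (kappa_convex : cone_convex K kappa).
Hypothesis kappa_nondecreasing : nondecreasing_cone K P kappa.
Hypothesis C_convex : @convex_set R X C.

Let K_0 : K 0. Proof. exact: (@K0 R Y K). Qed.

Definition conj_values (V : tvsType R) (E : V -> \bar Y) (L : V -> Y) :
  set (\bar Y) := [set ((L x)%:E - E x)%E | x in setT].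

Definition dual_sum (L L' : X -> Y) (T1 : W -> Y) (T2 : Z -> Y) : set (\bar Y) :=
  sumset (sumset (conj_values (bar \o F) L')
    (conj_values (Defs.lagrange H G C T1 T2) (L \- L')))
    (conj_values (bar \o kappa) T1).

Lemma uplus_dual_sum L L' T1 T2 :
  uplus K (uplus K (conjugate K (bar \o F) L')
    (conjugate K (Defs.lagrange H G C T1 T2) (L \- L')))
    (conjugate K (bar \o kappa) T1) = WSup K (dual_sum L L' T1 T2).
Proof. by rewrite /conjugate !uplus_WSup. Qed.

Lemma uplus_dual_sum_indicator L L' T1 T2 :
  uplus K (uplus K (uplus K (conjugate K (bar \o F) L')
    (conjugate K (Defs.lagrange H G C T1 T2) (L \- L')))
    (conjugate K (bar \o kappa) T1))
    (conjugate K (indicator (opp_set S)) T2) =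
  WSup K (sumset (dual_sum L L' T1 T2) (conj_values (indicator (opp_set S)) T2)).
Proof. by rewrite uplus_dual_sum /conjugate uplus_WSup. Qed.

(** Evaluating the conjugates at [x], [x], [H x] and [G x] cancels [L'], [T1] and [T2], leaving the
    negated primal value at [x]. *)
Lemma weak_duality (L L' : X -> Y) (T1 : W -> Y) (T2 : Z -> Y) :
  lower K (-%E @` primal_values S F kappa H G C L) `<=`
  lower K (sumset (dual_sum L L' T1 T2) (conj_values (indicator (opp_set S)) T2)).
Proof.
move=> w [_ [_ [x [Cx [s Ss Gx]] <-] <-]].
case Fx : (F x) => [f|]; last by case: w; rewrite /comp_ext; case: (obind _ _).
case Hx : (H x) => [h|]; rewrite /comp_ext Hx /=; last by case: w.
case kh : (kappa h) => [c|]; last by case: w.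
move=> wx; pose b : \bar Y := indicator (opp_set S) (- s).
exists (((L' x)%:E - bar (F x)) + (((L \- L') x)%:E - Defs.lagrange H G C T1 T2 x)
  + ((T1 h)%:E - bar (kappa h)) + ((T2 (- s))%:E - b))%E.
  by do 3?[apply: mem_sumset]; [exists x|exists x|exists h|exists (- s)].
move: wx; rewrite /b /Defs.lagrange Fx Hx kh Gx /indicator !mem_set//=; last first.
  by exists s.
by congr ltK; congr (_%:E); lmod R.
Qed.

(** For such [T2] the fourth conjugate is neutral, which links the two dual problems. As 0 may be
    missing from [S], the value 0 is approached through [T2 (- (e *: s))]. *)
Lemma lower_indicator (T2 : {linear Z -> Y}) : Lplus K S T2 ->
  lower K (conj_values (indicator (opp_set S)) T2) = lower K [set 0%:E].
Proof.
move=> [_ T2S]; apply/seteqP; split=> w.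
  move=> [_ [z _ <-] wz]; exists 0%:E => //; move: wz; rewrite /indicator.
  case: ifPn => [/set_mem[s Ss <-]|_]; last by case: w.
  move=> wz; apply: (ltK_leK_trans K_cone wz).
  apply/leK_fin; rewrite linearN oppr0 addr0 sub0r opprK.
  by apply: T2S; exists s.
move=> [_ -> w0]; have [s Ss] := S_nonempty.
have Ns z : S z -> conj_values (indicator (opp_set S)) T2 (T2 (- z))%:E.
  move=> Sz; exists (- z) => //; rewrite /indicator mem_set ?oppr0 ?adde0//=.
    by congr (_%:E); rewrite oppr0 addr0.
  by exists z.
case: w w0 => [y| |]//; last by move=> _; exists (T2 (- s))%:E => //; exact: Ns.
move=> /ltK_fin; rewrite sub0r => /(interior_line (- T2 s))[e e0 Ky].
exists (T2 (- (e *: s)))%:E; first by apply: Ns; apply: (proj2 S_cone).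
apply/ltK_fin; rewrite linearN linearZ addrC -scalerN.
by apply: Ky; rewrite gtr0_norm.
Qed.


Lemma dual_sum_fin L L' T1 T2 u w : dual_sum L L' T1 T2 u -> ltK K w u ->
  exists a f x h g, exists b c, [/\ F a = Some f, C x, H x = Some h,
    G x = Some g & kappa b = Some c /\
    u = (L' a - f + (L x - L' x - (T1 h + T2 g)) + (T1 b - c))%:E].
Proof.
move=> [_ [_ [a _ <-] [_ [x _ <-] <-]] [_ [b _ <-] <-]].
rewrite /Defs.lagrange /indicator /=.
case Fa : (F a) => [f|]; last by case: w.
case Hx : (H x) => [h|]; last by case: (G x) => [g|]; case: ifP; case: w.
case Gx : (G x) => [g|]; last by case: ifP; case: w.
case kb : (kappa b) => [c|]; last by case: ifP; case: w.
case: ifPn => [/set_mem Cx|_ /=]; last by case: w.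
move=> _; exists a, f, x, h, g, b, c; split=> //; split=> //.
by congr (_%:E); lmod R.
Qed.

(* The strict slack [p] in the argument of [kappa] keeps [Q] convex even when the
   origin is not in [P], where [H] is only convex up to elements of [P]. *)
Let Q (L : X -> Y) (y0 : Y) : set (X * W * Z * Y) :=
  [set q | exists x h g f c p s,
    [/\ C x, H x = Some h, G x = Some g, P p & S s] /\
    [/\ g + q.1.2 = - s, F (x + q.1.1.1) = Some f,
        kappa (h + q.1.1.2 + p) = Some c &
        K^° (q.2 + y0 - (f + c - L x))]].

Let convQ (L : {linear X -> Y}) y0 : convex_set (Q L y0).
Proof.
apply: convex_setI_strict => t [[[a1 b1] z1] y1] [[[a2 b2] z2] y2] /andP[t0 t1].
move=> [x1 [h1 [g1 [f1 [c1 [p1 [s1 [[Cx1 Hx1 Gx1 Pp1 Ss1] [/= gs1 Fx1 kh1 Ky1]]]]]]]]].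
move=> [x2 [h2 [g2 [f2 [c2 [p2 [s2 [[Cx2 Hx2 Gx2 Pp2 Ss2] [/= gs2 Fx2 kh2 Ky2]]]]]]]]].
have t01 : 0 <= t <= 1 by rewrite !ltW.
have r0 : 0 < 1 - t by rewrite subr_gt0.
have half (V : lmodType R) (A : set V) a : convex_cone A -> A a -> A (2%:R^-1 *: a).
  by move=> [_ coneA] Aa; apply: coneA => //; lra.
have mix (V : lmodType R) (A : set V) a b : convex_cone A -> A a -> A b ->
    A (2%:R^-1 *: (t *: a + (1 - t) *: b)).
  move=> coneA Aa Ab; apply: half => //.
  by apply: convex_combination => //; case: coneA.
(* For [H] and [G], half of each slack serves as the cone element that cone convexity asks for; the
   other half is returned to the new slack. *)
have [f [qf [Ff Kqf fE]]] := cone_convexP F_convex t01 Fx1 K_0 Fx2 K_0.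
have [h [qh [Hh Pqh hE]]] :=
  cone_convexP H_convex t01 Hx1 (half _ _ _ P_cone Pp1) Hx2 (half _ _ _ P_cone Pp2).
have [g [qg [Gg Sqg gE]]] :=
  cone_convexP G_convex t01 Gx1 (half _ _ _ S_cone Ss1) Gx2 (half _ _ _ S_cone Ss2).
have [c [qc [kc Kqc cE]]] := cone_convexP kappa_convex t01 kh1 K_0 kh2 K_0.
exists (t *: x1 + (1 - t) *: x2), h, g, f, c,
  (2%:R^-1 *: (t *: p1 + (1 - t) *: p2) + qh),
  (2%:R^-1 *: (t *: s1 + (1 - t) *: s2) + qg).
split; split => //.
- exact: convex_combination.
- by apply: convex_coneD => //; exact: mix.
- by apply: convex_coneD => //; exact: mix.
- rewrite /=; have -> : g = t *: (g1 + 2^-1 *: s1) + (1 - t) *: (g2 + 2^-1 *: s2) - qg.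
    by rewrite gE addrK.
  have -> : z1 = - s1 - g1 by rewrite -gs1 addrC addKr.
  have -> : z2 = - s2 - g2 by rewrite -gs2 addrC addKr.
  by lmod R.
- by rewrite -Ff; congr F; rewrite /=; lmod R.
- rewrite -kc; congr kappa; rewrite /=.
  have -> : qh = t *: (h1 + 2^-1 *: p1) + (1 - t) *: (h2 + 2^-1 *: p2) - h.
    by rewrite hE addrC addKr.
  by lmod R.
- have LE : L (t *: x1 + (1 - t) *: x2) = t *: L x1 + (1 - t) *: L x2.
    by rewrite linearD !linearZ.
  rewrite /= LE.
  have -> : f = t *: (f1 + 0) + (1 - t) *: (f2 + 0) - qf by rewrite fE addrK.
  have -> : c = t *: (c1 + 0) + (1 - t) *: (c2 + 0) - qc by rewrite cE addrK.
  pose k1 := y1 + y0 - (f1 + c1 - L x1); pose k2 := y2 + y0 - (f2 + c2 - L x2).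
  rewrite [X in _^° X](_ : _ = t *: k1 + ((1 - t) *: k2 + (qf + qc))); last first.
    by rewrite /k1 /k2; lmod R.
  apply: interior_coneD => //; first exact: interior_coneZ.
  apply: convex_coneD => //; last exact: convex_coneD.
  by apply: (proj2 K_cone) => //; exact: interior_subset.
Qed.

Hypothesis meet : feasible S G C `&` domain F
  `&` [set x | exists2 w, domain kappa w & H x = Some w] !=set0.

(** Monotonicity also forces [kappa w] to be finite, since +oo is below no point of [Y]. *)
Lemma kappa_le w p c : P p -> kappa (w + p) = Some c ->
  exists2 c', kappa w = Some c' & K (c - c').
Proof.
move=> Pp kwp; have /kappa_nondecreasing : opp_set P (w - (w + p)).
  by apply/opp_setE; rewrite opprB addrC addKr.
rewrite kwp; case: (kappa w) => [c'|]// /leK_fin; by exists c'.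
Qed.

Let Zs := Z0 S F kappa H G C.

Let ZsE x h g a b s f c : C x -> H x = Some h -> G x = Some g -> S s ->
  F a = Some f -> kappa b = Some c -> Zs (a - x, b - h, - s - g).
Proof.
move=> Cx Hx Gx Ss Fa kb.
have -> : (a - x, b - h, - s - g) = - 1 *: ((x, h, g) - (a, b, - s)).
  by rewrite scaleN1r opprB.
apply: linZ; apply: sub_lin; exists (x, h, g); first by split.
exists (a, b, - s) => //; split; last by exists s.
by split; rewrite /domain/= ?Fa ?kb.
Qed.

(** As [kappa] stays finite at [w - p], the vector is a difference of two elements of the span. *)
Let ZsP p : P p -> Zs (0, p, 0).
Proof.
move=> Pp; have [x [[[Cx [s Ss Gx]] ]]] := meet.
rewrite /domain /=; case Fx : (F x) => [f|]// _ [w + Hx].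
case kw : (kappa w) => [c|]// _.
have [c' kwp _] : exists2 c', kappa (w - p) = Some c' & K (c - c').
  by apply: (kappa_le Pp); rewrite subrK.
have -> : (0, p, 0) = (x - x, w - w, - s - - s) - (x - x, w - p - w, - s - - s).
  by congr (_, _, _); rewrite /=; lmod R.
by apply: linB; [exact: (ZsE Cx Hx Gx Ss Fx kw)|exact: (ZsE Cx Hx Gx Ss Fx kwp)].
Qed.

Let QZ L y0 u y : Q L y0 (u, y) -> Zs u.
Proof.
case: u => [[a b] z].
move=> [x [h [g [f [c [p [s [[Cx Hx Gx Pp Ss] [/= gs Fx khp _]]]]]]]]].
have [c' kh _] := kappa_le Pp khp.
have -> : (a, b, z) = (x + a - x, h + b - h, - s - g).
  by rewrite -gs; congr (_, _, _); lmod R.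
exact: (ZsE Cx Hx Gx Ss Fx kh).
Qed.

Lemma feasible_lower (L : X -> Y) x f h c s w : C x -> S s -> G x = Some (- s) ->
  F x = Some f -> H x = Some h -> kappa h = Some c ->
  ltK K w (- (f + c - L x))%:E ->
  lower K (-%E @` primal_values S F kappa H G C L) w.
Proof.
move=> Cx Ss Gx Fx Hx kh wx; exists (- (f + c - L x))%:E => //.
exists (f + c - L x)%:E => //; exists x; first by split=> //; exists s.
by rewrite Fx /comp_ext Hx /= kh.
Qed.

Let Q0 L y0 : ~ lower K (-%E @` primal_values S F kappa H G C L) (- y0)%:E ->
  ~ Q L y0 (0, 0).
Proof.
move=> ny0 [x [h [g [f [c [p [s [[Cx Hx Gx Pp Ss] [/=]]]]]]]]].
rewrite !addr0 => gs Fx /(kappa_le Pp)[c' kh Kc].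
rewrite add0r => Ky; apply: ny0.
apply: (feasible_lower Cx Ss _ Fx Hx kh); first by rewrite Gx gs.
apply/ltK_fin.
have -> : - (f + c' - L x) - - y0 = y0 - (f + c - L x) + (c - c') by lmod R.
exact: interior_coneD.
Qed.

Lemma separating_functionals (L : {linear X -> Y}) (k y0 yL : Y)
    (WL : set (X * W * Z)) :
  K^° k -> nbhs (0, 0, 0) WL ->
  (forall x' w z, (WL `&` Zs) (x', w, z) ->
     exists x, [/\ C x,
       exists2 s, S s & omap (fun g => g + z) (G x) = Some (- s) &
       leK K (bar (F (x + x')%R)
              + bar (obind (fun h => kappa (h + w)%R) (H x))
              - (L x)%:E)%E yL%:E]) ->
  ~ lower K (-%E @` primal_values S F kappa H G C L) (- y0)%:E ->
  exists (a : X -> R) (b : W -> R) (d : Z -> R) (l : Y -> R),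
  [/\ [/\ scalar a, scalar b, scalar d & scalar l],
      l k = 1, forall y, K y -> 0 <= l y,
      exists r U1 U2 U3, [/\ nbhs 0 U1, nbhs 0 U2 & nbhs 0 U3] /\
        [/\ forall x, U1 x -> a x <= r, forall w, U2 w -> b w <= r &
           forall z, U3 z -> d z <= r] &
      forall x h g s f c x' w, C x -> H x = Some h -> G x = Some g -> S s ->
        F x' = Some f -> kappa w = Some c ->
        a (x' - x) + b (w - h) + d (- s - g) + l y0 <= l (f + c - L x)].
Proof.
move=> Kk WL0 qual ny0; have [p0 Pp0] := P_nonempty.
(* The qualification will be used at [w + e *: p0], so that [e *: p0] serves as the slack in [Q];
   splitting [WL] leaves room for this shift. *)
have := @add_continuous (X * W * Z)%type (0, 0); rewrite /continuous_at/= addr0.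
move=> /(_ _ WL0)[]/= [A1 A2]/= [A10 A20] AWL.
have [e e0 A2e] := nbhs_absorb ((0, p0, 0) : X * W * Z) A20.
have [B [B0 BA1 convB]] := convex_nbhs A10.
have Pep0 : P (e *: p0) by apply: (proj2 P_cone).
(* The summand [k] turns the inequality with [yL] into interior membership. *)
have BQ u : B u -> Zs u -> Q L y0 (u, yL - y0 + k).
  case: u => [[x' w] z] Bu Zu.
  have eE : e *: ((0, p0, 0) : X * W * Z) = (0, e *: p0, 0).
    by congr (_, _, _); rewrite /= scaler0.
  have [|x [Cx [s Ss]]] := qual x' (w + e *: p0) z.
    have -> : (x', w + e *: p0, z) = (x', w, z) + (0, e *: p0, 0).
      by congr (_, _, _); rewrite /= addr0.
    split; first by rewrite -eE; apply: (AWL (_, _)); split => //; exact: BA1.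
    by rewrite addrC -[(0, _, 0)]scale1r; apply: linP => //; exact: ZsP.
  case Gx : (G x) => [g|]//= [gs].
  case Fx : (F (x + x')) => [f|]; last first.
    by case: (obind _ _) => [?|].
  case Hx : (H x) => [h|]//=.
  case kh : (kappa _) => [c|]//= /leK_fin Ky.
  exists x, h, g, f, c, (e *: p0), s; split; split => //=.
    by rewrite -addrA.
  have -> : yL - y0 + k + y0 - (f + c - L x) = k + (yL - (f + c - L x)) by lmod R.
  exact: interior_coneD.
have upQ u y q : K q -> Q L y0 (u, y) -> Q L y0 (u, y + q).
  move=> Kq [x [h [g [f [c [p [s [Qx [/= gs Fx kh Ky]]]]]]]]].
  exists x, h, g, f, c, p, s; split => //; split => //=.
  have -> : y + q + y0 - (f + c - L x) = y + y0 - (f + c - L x) + q by lmod R.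
  exact: interior_coneD.
have [a [l [lin_a lin_l lk lK [Qal Bal]]]] :=
  @relative_separation R (X * W * Z)%type Y K k K_cone K_0 Kk (Q L y0) Zs B
    (yL - y0 + k) (@convQ L y0) (@Q0 L y0 ny0) upQ (@QZ L y0) (@lin0 _ _ _)
    (fun t u => @linZ _ _ _ t u) B0 convB BQ.
exists (fun x => a (x, 0, 0)), (fun w => a (0, w, 0)), (fun z => a (0, 0, z)), l.
have aE x w z : a (x, w, z) = a (x, 0, 0) + a (0, w, 0) + a (0, 0, z).
  rewrite -!(functionalD lin_a); congr a; congr (_, _, _); rewrite /=; lmod R.
split => //.
- split=> // t u v; rewrite -lin_a; congr a; congr (_, _, _); rewrite /=; lmod R.
- exists (l (yL - y0 + k)), [set x | B (x, 0, 0)], [set w | B (0, w, 0)],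
    [set z | B (0, 0, z)].
  have [/nbhs_pair0[B1 B2] B3] := nbhs_pair0 B0.
  by split; split => // u; exact: Bal.
- move=> x h g s f c x' w Cx Hx Gx Ss Fx kw.
  rewrite -aE -subr_ge0.
  (* Membership in [Q] requires a slack [t *: p0] and a margin [t *: k]; both disappear as [t] tends
     to 0. *)
  apply: (@nonneg_limit _ _ (1 + a (0, p0, 0))) => t t0.
  have Ptp : P (t *: p0) by apply: (proj2 P_cone).
  have := Qal (x' - x, w - h - t *: p0, - s - g) (f + c - L x - y0 + t *: k).
  have -> : a (x' - x, w - h - t *: p0, - s - g) =
      a (x' - x, w - h, - s - g) - t * a (0, p0, 0).
    rewrite -(functionalZ lin_a) -(functionalB lin_a); congr a.
    by congr (_, _, _); rewrite /=; lmod R.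
  rewrite (functionalD lin_l (_ - y0)) (functionalB lin_l _ y0) (functionalZ lin_l) lk.
  move=> Qa; suff /Qa : Q L y0 (x' - x, w - h - t *: p0, - s - g,
    f + c - L x - y0 + t *: k) by lra.
  exists x, h, g, f, c, (t *: p0), s; split; split=> //=.
  + by rewrite addrC subrK.
  + by rewrite addrC subrK.
  + by rewrite -kw; congr kappa; lmod R.
  + rewrite (_ : _ - _ = t *: k); last by lmod R.
    exact: interior_coneZ.
Qed.

Lemma nbhs0_sub_interior k : K^° k -> nbhs 0 [set y | K^° (k - y)].
Proof.
move=> /nbhs_interior/(nbhsB (- k)); rewrite addNr => /nbhs0N.
by apply: filterS => _ [_ [y Ky <-] <-] /=; rewrite opprK addrA subrr add0r.
Qed.

Lemma kappa_properP : exists b c, kappa b = Some c.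
Proof.
have [_ [_ [w + _]]] := meet.
by rewrite /domain/=; case kw : (kappa w) => [c|]// _; exists w, c.
Qed.

(** * Admissible multipliers for [kappa] *)

Section BoundedMultiplier.
Variables (b : W -> R) (l : Y -> R) (k : Y) (r : R).
Hypotheses (lin_b : scalar b) (lin_l : scalar l) (lk : l k = 1).
Hypothesis lK : forall y, K y -> 0 <= l y.
Hypothesis br : forall w c, kappa w = Some c -> b w - l c <= r.

(** Along [- p] the values of [kappa] do not increase, so a negative [b p] would make [b w - l c]
    unbounded. *)
Lemma bounded_multiplier_ge0 p : P p -> 0 <= b p.
Proof.
move=> Pp; have [w [c kw]] := kappa_properP.
apply: (@nonneg_slope _ (r - b w + l c)) => t t0.
have Ptp : P (t *: p) by apply: (proj2 P_cone).
have [|c' kwp /lK] := @kappa_le (w - t *: p) _ c Ptp; first by rewrite subrK.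
have := br kwp.
by rewrite (functionalB lin_l) (functionalB lin_b) (functionalZ lin_b); lra.
Qed.

Lemma bounded_multiplier_dom_conj (T : {linear W -> Y}) :
  continuous T -> (forall w, T w = b w *: k) -> dom_conj K (bar \o kappa) T.
Proof.
move=> contT TE; split=> // TT.
have : conjugate K (bar \o kappa) T +oo%E by rewrite TT.
move=> /WSup_lower[_ /(_ (r *: k)%:E I)[_ [w _ <-]]] /=.
case kw : (kappa w) => [c|]// /ltK_fin.
move=> /(positive_functional_interior lin_l lK lk).
have := br kw.
by rewrite TE !(functionalB lin_l) !(functionalZ lin_l) lk; lra.
Qed.

End BoundedMultiplier.

(* A multiplier in the domain of the conjugate of [kappa] need not map [P] into
   [K]; composing it with a suitable positive functional [l] and multiplying by
   [k] produces one that does. *)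
Lemma bounded_multiplier_exists k : K^° k -> dom_conj K (bar \o kappa) !=set0 ->
  exists T : {linear W -> Y}, dom_conj K (bar \o kappa) T /\ Lplus K P T.
Proof.
move=> Kk [T [contT Tdom]].
have [y1 ny1] : exists y1, ~ lower K (conj_values (bar \o kappa) T) y1%:E.
  apply: contrapT => /forallNP ny; apply: Tdom; apply: WSup_pinfty => // y.
  exact: contrapT (ny y).
(* If 0 were in [N], [y1] would lie strictly below a value of [T - kappa]. Separating [N] from 0
   bounds [l (T w) - l c] by [l y1]. *)
pose N : set Y := [set n | exists b c, kappa b = Some c /\ K^° (n - (y1 - T b + c))].
have convN : convex_set N.
  apply: convex_setI_strict => t n1 n2 /andP[t0 t1].
  move=> [b1 [c1 [kb1 Kn1]]] [b2 [c2 [kb2 Kn2]]].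
  have t01 : 0 <= t <= 1 by rewrite !ltW.
  have [c [q [kb Kq cE]]] := cone_convexP kappa_convex t01 kb1 K_0 kb2 K_0.
  exists (t *: b1 + (1 - t) *: b2), c; split => //.
  have TE : T (t *: b1 + (1 - t) *: b2) = t *: T b1 + (1 - t) *: T b2.
    by rewrite linearD !linearZ.
  have -> : c = t *: (c1 + 0) + (1 - t) *: (c2 + 0) - q by rewrite cE addrK.
  pose m1 := n1 - (y1 - T b1 + c1); pose m2 := n2 - (y1 - T b2 + c2).
  rewrite TE [X in _^° X](_ : _ = t *: m1 + ((1 - t) *: m2 + q)); last first.
    by rewrite /m1 /m2; lmod R.
  apply: interior_coneD => //; first exact: interior_coneZ.
  apply: convex_coneD => //; apply: (proj2 K_cone); first by rewrite subr_gt0.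
  exact: interior_subset.
have upN n q : K q -> N n -> N (n + q).
  move=> Kq [b [c [kb Kn]]]; exists b, c; split => //.
  by rewrite addrAC; exact: interior_coneD.
have [b0 [c0 kb0]] := kappa_properP.
have absN n : exists t, N (n + t *: k).
  have [t _ /(_ _ (lexx _)) Kt] :=
    interior_cone_absorb (n - (y1 - T b0 + c0)) K_cone Kk.
  by exists t, b0, c0; split => //; rewrite addrAC.
have N0 : ~ N 0.
  move=> [b [c [kb Kn]]]; apply: ny1; exists (T b - c)%:E.
    by exists b => //=; rewrite kb.
  by apply/ltK_fin; have -> : T b - c - y1 = 0 - (y1 - T b + c) by lmod R.
have [|l [lin_l lk lN]] := @separation R Y N k convN N0 _ absN.
  move=> n t; rewrite le_eqVlt => /predU1P[<-|t0] Nn; first by rewrite scale0r addr0.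
  apply: upN => //; apply: (proj2 K_cone) => //; exact: interior_subset.
have lK y : K y -> 0 <= l y.
  move=> Ky; have [t Nt] := absN 0.
  apply: (@nonneg_slope _ (l (0 + t *: k))) => s s0.
  rewrite -(functionalZ lin_l) -(functionalD lin_l).
  by apply/lN/upN => //; apply: (proj2 K_cone).
pose p w := l (T w).
have lin_p : scalar p by move=> t u v; rewrite /p linearP lin_l.
have pr w c : kappa w = Some c -> p w - l c <= l y1.
  move=> kw; suff : 0 <= l y1 - p w + l c by lra.
  apply: (@nonneg_limit _ _ 1) => t t0.
  have := lN (y1 - T w + c + t *: k).
  rewrite !(functionalD lin_l) (functionalN lin_l) (functionalZ lin_l) lk.
  apply; exists w, c; split => //.
  by rewrite addrAC subrr add0r; exact: interior_coneZ.
have nbhsp : nbhs 0 [set w | K^° (k - T w)].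
  have := contT 0; rewrite /continuous_at linear0 => Tc.
  exact: Tc (nbhs0_sub_interior Kk).
have p1 w : K^° (k - T w) -> p w <= 1.
  move=> /interior_subset/lK; rewrite (functionalB lin_l) lk -/(p w); lra.
have [T' contT' T'E] := rank_one k lin_p nbhsp p1.
exists T'; split; first exact: (bounded_multiplier_dom_conj lin_l lk lK pr).
split => // _ [w Pw <-]; rewrite T'E.
have := bounded_multiplier_ge0 lin_p lin_l lK pr Pw.
rewrite le_eqVlt => /predU1P[<-|pw]; first by rewrite scale0r; exact: K_0.
by apply: (proj2 K_cone) => //; exact: interior_subset.
Qed.

(** * Weak and strong duality for the dual value sets *)

Lemma lower_sumset_indicator N (T2 : {linear Z -> Y}) : Lplus K S T2 ->
  lower K (sumset N (conj_values (indicator (opp_set S)) T2)) = lower K N.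
Proof.
move=> /lower_indicator T20; transitivity (lower K (sumset N [set 0%:E])).
  exact: lower_sumset.
congr lower; apply/seteqP; split=> [_ [u Nu [_ -> <-]]|u Nu].
  by rewrite ext_addr0.
by exists u => //; exists 0%:E => //; rewrite ext_addr0.
Qed.

Lemma dual_values_plus_sub L :
  dual_values_plus K P S F kappa H G C L `<=` dual_values K S F kappa H G C L.
Proof.
move=> u [L' cL' [T1 [dT1 _] [T2 pT2 [v + <-]]]].
rewrite uplus_dual_sum => Lv; exists L' => //; exists T1 => //; exists T2.
  have [cT2 T2S] := pT2; split=> //; rewrite -subset0 => _ [[z Sz <-] /opp_setE Kz].
  apply: (proper_cone_interior0 K_cone K_proper).
  by rewrite -(addNr (T2 z)); apply: interior_coneD => //; apply: T2S; exists z.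
exists v => //; rewrite uplus_dual_sum_indicator.
by rewrite (eq_WSup (lower_sumset_indicator _ pT2)).
Qed.

Lemma weak_duality_values L u : dual_values K S F kappa H G C L u ->
  ~ lower K (-%E @` primal_values S F kappa H G C L) (- u)%E.
Proof.
move=> [L' _ [T1 _ [T2 _ [v + <-]]]]; rewrite ext_oppK uplus_dual_sum_indicator.
by move=> /WSup_lower[+ _]; apply: contra_not; exact: weak_duality.
Qed.

Lemma dual_values_plus_intro (L L' : {linear X -> Y}) (T1 : {linear W -> Y})
    (T2 : {linear Z -> Y}) v :
  continuous L' -> dom_conj K (bar \o kappa) T1 -> Lplus K P T1 ->
  Lplus K S T2 -> WSup K (dual_sum L L' T1 T2) v ->
  dual_values_plus K P S F kappa H G C L (- v)%E.
Proof.
move=> cL' dT1 pT1 pT2 Lv; exists L' => //; exists T1 => //; exists T2 => //.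
by exists v => //; rewrite uplus_dual_sum.
Qed.

Lemma lower_dual_sum L L' T1 (T2 : {linear Z -> Y}) : Lplus K S T2 ->
  lower K (-%E @` primal_values S F kappa H G C L) `<=`
  lower K (dual_sum L L' T1 T2).
Proof.
move=> pT2; rewrite -(lower_sumset_indicator (dual_sum L L' T1 T2) pT2).
exact: weak_duality.
Qed.

Lemma strong_duality_values (L : {linear X -> Y}) (yL : Y) (WL : set (X * W * Z)) v :
  dom_conj K (bar \o kappa) !=set0 -> nbhs (0, 0, 0) WL ->
  (forall x' w z, (WL `&` Zs) (x', w, z) ->
     exists x, [/\ C x,
       exists2 s, S s & omap (fun g => g + z) (G x) = Some (- s) &
       leK K (bar (F (x + x')%R)
              + bar (obind (fun h => kappa (h + w)%R) (H x))
              - (L x)%:E)%E yL%:E]) ->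
  WSup K (-%E @` primal_values S F kappa H G C L) v ->
  dual_values_plus K P S F kappa H G C L (- v)%E.
Proof.
move=> dom_kappa WL0 qual Lv; have [k Kk] := K_int.
have kT t : 0 <= t -> K (t *: k).
  rewrite le_eqVlt => /predU1P[<-|t0]; first by rewrite scale0r.
  by apply: (proj2 K_cone) => //; exact: interior_subset.
case: v Lv => [y| |] /WSup_lower[nLv Lv].
- have ny : ~ lower K (-%E @` primal_values S F kappa H G C L) (- - y)%:E.
    by rewrite opprK.
  have [a [b [d [l [[lin_a lin_b lin_d lin_l] lk lK
    [r [U1 [U2 [U3 [[U10 U20 U30] [ar br dr]]]]]] sep]]]]] :=
    separating_functionals Kk WL0 qual ny.
  have [x0 [[[Cx0 [s0 Ss0 Gx0]]]]] := meet.
  rewrite /domain /=; case Fx0 : (F x0) => [f0|]// _ [h0 + Hx0].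
  case kh0 : (kappa h0) => [c0|]// _.
  have [L' cL' L'E] := rank_one k lin_a U10 ar.
  have [T1 cT1 T1E] := rank_one k lin_b U20 br.
  have [T2 cT2 T2E] := rank_one k lin_d U30 dr.
  (* Replacing [s] by [t *: s] yields two facts: large [t] gives [0 <= d s], and small [t]
     eliminates [s]. *)
  have sep_slope x h g f c x' w s t : C x -> H x = Some h -> G x = Some g ->
      F x' = Some f -> kappa w = Some c -> S s -> 0 < t ->
      0 <= l f + l c - l (L x) + l y - a x' + a x - b w + b h + d g + t * d s.
    move=> Cx Hx Gx Fx' kw Ss t0.
    have := sep _ _ _ _ _ _ _ _ Cx Hx Gx (proj2 S_cone _ _ t0 Ss) Fx' kw.
    rewrite (functionalB lin_a) (functionalB lin_b) (functionalB lin_d).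
    rewrite (functionalN lin_d) (functionalZ lin_d) (functionalN lin_l).
    by rewrite (functionalB lin_l) (functionalD lin_l); lra.
  have d_ge0 s : S s -> 0 <= d s.
    move=> Ss; apply: nonneg_slope => t.
    exact: (sep_slope _ _ _ _ _ _ _ _ _ Cx0 Hx0 Gx0 Fx0 kh0 Ss).
  have sep0 x h g f c x' w : C x -> H x = Some h -> G x = Some g ->
      F x' = Some f -> kappa w = Some c ->
      0 <= l f + l c - l (L x) + l y - a x' + a x - b w + b h + d g.
    move=> Cx Hx Gx Fx' kw; apply: (@nonneg_limit _ _ (d s0)) => t.
    exact: sep_slope.
  have b_le w c : kappa w = Some c ->
      b w - l c <= l f0 - l (L x0) + l y + b h0 + d (- s0).
    by move=> kw; have := sep0 _ _ _ _ _ _ _ Cx0 Hx0 Gx0 Fx0 kw; lra.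
  apply: (@dual_values_plus_intro L L' T1 T2 y%:E cL').
  + exact: (bounded_multiplier_dom_conj lin_l lk lK b_le).
  + split=> // _ [p Pp <-]; rewrite T1E; apply: kT.
    exact: (bounded_multiplier_ge0 lin_b lin_l lK b_le).
  + by split=> // _ [s Ss <-]; rewrite T2E; apply: kT; exact: d_ge0.
  + apply/WSup_lower; split=> [[u Su yu]|w wy]; last first.
      apply: lower_dual_sum; last exact: Lv.
      by split=> // _ [s Ss <-]; rewrite T2E; apply: kT; exact: d_ge0.
    (* A term [u] strictly above [y] would satisfy [l y < l u], against [sep0], because [l] sends
       [a x *: k] back to [a x]. *)
    have [x' [f [x [h [g [w [c [Fx' Cx Hx Gx [kw uE]]]]]]]]] := dual_sum_fin Su yu.
    move: yu; rewrite uE L'E T1E T1E T2E L'E => /ltK_fin.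
    move=> /(positive_functional_interior lin_l lK lk).
    have := sep0 _ _ _ _ _ _ _ Cx Hx Gx Fx' kw.
    rewrite !(functionalD lin_l) !(functionalN lin_l) !(functionalD lin_l).
    by rewrite !(functionalZ lin_l) lk; lra.
(* The weak infimum is -oo here. Zero operators for [L'] and [T2] suffice, since weak duality
   already pushes the dual weak supremum to +oo. *)
- have [T1 [dT1 pT1]] := bounded_multiplier_exists Kk dom_kappa.
  have lin0 (V : lmodType R) : scalar (fun _ : V => 0 : R).
    by move=> t u w; rewrite mulr0 addr0.
  have [L' cL' _] :=
    rank_one k (lin0 X) (@filterT _ _ (nbhs_filter 0)) (fun _ _ => lexx 0).
  have [T2 cT2 T2E] :=
    rank_one k (lin0 Z) (@filterT _ _ (nbhs_filter 0)) (fun _ _ => lexx 0).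
  have pT2 : Lplus K S T2 by split=> // _ [z _ <-]; rewrite T2E; exact: kT.
  apply: (dual_values_plus_intro cL' dT1 pT1 pT2).
  by rewrite WSup_pinfty // => y; apply: lower_dual_sum => //; exact: Lv.
- have [x [[[Cx [s Ss Gx]]]]] := meet.
  rewrite /domain /=; case Fx : (F x) => [f|]// _ [w + Hx].
  case kw : (kappa w) => [c|]// _.
  by case: nLv; apply: (feasible_lower Cx Ss Gx Fx Hx kw).
Qed.

End StrongDuality.

Theorem corollary5p5 (R : realType) (X Y Z W : tvsType R)
  (hX : hausdorff_space X) (hY : hausdorff_space Y)
  (hZ : hausdorff_space Z) (hW : hausdorff_space W)
  (K : set Y) (P : set W) (S : set Z)
  (K_proper : K <> setT) (K_closed : closed K) (K_cone : convex_cone K)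
  (K_int : K^° !=set0)
  (P_cone : convex_cone P) (P_nonempty : P !=set0)
  (S_cone : convex_cone S) (S_nonempty : S !=set0)
  (F : X -> option Y) (kappa : W -> option Y)
  (H : X -> option W) (G : X -> option Z)
  (F_proper : proper_map F) (kappa_proper : proper_map kappa)
  (H_proper : proper_map H) (G_proper : proper_map G)
  (C : set X) (C_nonempty : C !=set0)
  (meet : feasible S G C `&` domain F
            `&` [set x | exists2 w, domain kappa w & H x = Some w] !=set0)
  (F_convex : cone_convex K F) (H_convex : cone_convex P H)
  (G_convex : cone_convex S G) (kappa_convex : cone_convex K kappa)
  (kappa_nondecreasing : nondecreasing_cone K P kappa)
  (C_convex : @convex_set R X C)
  (* Without this the dual index set is empty and the equality fails, e.g. for
     X = W infinite-dimensional, Y = R, F = 0, H = id, G = 0, C = X, P = S = {0}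
     and kappa a discontinuous linear functional. *)
  (dom_kappa_conj : dom_conj K (bar \o kappa) !=set0)
  (qualification : forall L : {linear X -> Y}, continuous L ->
     exists (yL : Y) (WL : set (X * W * Z)), nbhs (0, 0, 0) WL /\
       forall x' w z, (WL `&` Z0 S F kappa H G C) (x', w, z) ->
         exists x, [/\ C x,
           exists2 s, S s & omap (fun g => g + z) (G x) = Some (- s) &
           leK K (bar (F (x + x')%R)
                  + bar (obind (fun h => kappa (h + w)%R) (H x))
                  - (L x)%:E)%E yL%:E]) :
  forall L : {linear X -> Y}, continuous L ->
    WInf K (primal_values S F kappa H G C L) = WMax K (dual_values K S F kappa H G C L) /\
    WMax K (dual_values K S F kappa H G C L) = WMax K (dual_values_plus K P S F kappa H G C L).
Proof.
move=> L contL; have [yL [WL [WL0 qual]]] := qualification L contL.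
have strong v : WSup K (-%E @` primal_values S F kappa H G C L) v ->
    dual_values_plus K P S F kappa H G C L (- v)%E.
  exact: (strong_duality_values K_closed K_cone K_int P_cone P_nonempty
    S_cone S_nonempty F_convex H_convex G_convex kappa_convex kappa_nondecreasing
    C_convex meet dom_kappa_conj WL0 qual).
have sub : dual_values_plus K P S F kappa H G C L `<=` dual_values K S F kappa H G C L.
  exact: dual_values_plus_sub.
have weak u : dual_values K S F kappa H G C L u ->
    ~ lower K (-%E @` primal_values S F kappa H G C L) (- u)%E.
  exact: weak_duality_values.
have primal_dual : WInf K (primal_values S F kappa H G C L) =
    WMax K (dual_values K S F kappa H G C L).
  by apply: WInf_eq_WMax => // v /strong /sub.
split=> //; rewrite -primal_dual.
by apply: WInf_eq_WMax => // u /sub; exact: weak.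
Qed.
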